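(* Let $X$ be a martingale which is an almost-continuous diffusion, and let $g:\mathbb{R}\to\mathbb{R}$ be a Lipschitz continuous function such that $k\le g'\le K$, where $k\le K$ are real numbers. Then for any $t<T$ in $\mathbb{R}_+$ there exists a Lipschitz continuous $f:\mathbb{R}\to\mathbb{R}$ such that $k\le f'\le K$ and $f(X_t)=\mathbb{E}[g(X_T)\mid\mathcal{F}_t]$ almost surely.
   Context: All processes are indexed by $t\in\mathbb{R}_+=[0,\infty)$ and are defined with respect to a filtered probability space $(\Omega,\mathcal{F},(\mathcal{F}_t)_{t\in\mathbb{R}_+},\mathbb{P})$. Notation: for $f:\mathbb{R}\to\mathbb{R}$ and real $k\le K$, ''$k\le f'\le K$'' means $k(y-x)\le f(y)-f(x)\le K(y-x)$ for all real $x<y$. Strong Markov: a real valued process $X$ is strong Markov if for every bounded measurable $g:\mathbb{R}\to\mathbb{R}$ and every $t\in\mathbb{R}_+$ there exists a measurable $f:\mathbb{R}_+\times\mathbb{R}\to\mathbb{R}$ such that $f(\tau,X_\tau)=\mathbb{E}[g(X_{\tau+t})\mid\mathcal{F}_\tau]$ (a.s.) for every finite stopping time $\tau$. Almost-continuous: a real valued process $X$ is almost-continuous if it is cadlag, continuous in probability, and given any two independent, identically distributed cadlag processes $Y,Z$ with the same distribution as $X$, for every $s<t$ in $\mathbb{R}_+$, $$\mathbb{P}\left(Y_s<Z_s,\ Y_t>Z_t \text{ and } Y_u\neq Z_u \text{ for every } u\in(s,t)\right)=0.$$ An almost-continuous diffusion is a process that is both strong Markov and almost-continuous. *)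

(* Defs.v *)
From HB Require Import structures.
From mathcomp Require Import all_boot all_order all_algebra.
From mathcomp Require Import all_classical all_reals all_analysis.

Set Implicit Arguments.
Unset Strict Implicit.
Unset Printing Implicit Defensive.

Import Order.TTheory GRing.Theory Num.Theory.
Import numFieldNormedType.Exports.

Local Open Scope classical_set_scope.
Local Open Scope ring_scope.

(* The time set R_+ is represented by the nonnegative elements of R: processes,
   filtrations and paths are indexed by R, and their values at negative times
   are never used. *)

Record filtration d (Omega : measurableType d) (R : realType) := Filtration {
  filt :> R -> set_system Omega ;
  filt_sigma : forall t, 0 <= t -> sigma_algebra setT (filt t) ;
  filt_sub : forall t, 0 <= t -> filt t `<=` measurable ;
  filt_mono : forall s t, 0 <= s -> s <= t -> filt s `<=` filt t }.

Section conditional_expectation.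
Context d (Omega : measurableType d) (R : realType).
Variables (P : probability Omega R) (G : set_system Omega) (U : Omega -> R).

Record is_condexp (V : Omega -> R) : Prop := {
  condexp_integrable_arg : P.-integrable setT (EFin \o U) ;
  condexp_integrable : P.-integrable setT (EFin \o V) ;
  condexp_measurable : measurable_fun setT (V : g_sigma_algebraType G -> R) ;
  condexp_integral : forall A, G A ->
    (\int[P]_(w in A) (V w)%:E = \int[P]_(w in A) (U w)%:E)%E }.

(* "Z = E[U | G] almost surely"; Z itself need not be G-measurable, as G is not
   assumed to contain the P-null sets. *)
Definition ae_eq_condexp (Z : Omega -> R) : Prop :=
  exists2 V, is_condexp V & \forall w \ae P, Z w = V w.

End conditional_expectation.

Section stopping_times.
Context d (Omega : measurableType d) (R : realType).
Variable F : filtration Omega R.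

Definition finite_stopping_time (tau : Omega -> R) : Prop :=
  (forall w, 0 <= tau w) /\ (forall t, 0 <= t -> F t [set w | tau w <= t]).

Definition stopped_sigma_algebra (tau : Omega -> R) : set_system Omega :=
  [set A | measurable A /\
           forall t, 0 <= t -> F t (A `&` [set w | tau w <= t])].

End stopping_times.

Section processes.
Context d (Omega : measurableType d) (R : realType).
Variables (P : probability Omega R) (F : filtration Omega R).
Variable X : R -> {RV P >-> R}.

Definition adapted : Prop :=
  forall t, 0 <= t -> measurable_fun setT (X t : g_sigma_algebraType (F t) -> R).

Definition martingale : Prop :=
  [/\ adapted,
      forall t, 0 <= t -> P.-integrable setT (EFin \o X t) &
      forall s t, 0 <= s -> s <= t -> ae_eq_condexp P (F s) (X t) (X s)].

Definition strong_markov : Prop :=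
  forall g : R -> R, measurable_fun setT g -> bounded_fun g ->
  forall t : R, 0 <= t ->
  exists2 f : R * R -> R,
    measurable_fun ([set u : R | 0 <= u] `*` [set: R]) f &
    forall tau, finite_stopping_time F tau ->
      ae_eq_condexp P (stopped_sigma_algebra F tau)
        (fun w => g (X (tau w + t) w)) (fun w => f (tau w, X (tau w) w)).

Definition cadlag : Prop := forall w,
  (forall t, 0 <= t -> X s w @[s --> t^'+] --> X t w) /\
  (forall t, 0 < t -> cvg (X s w @[s --> t^'-])).

Definition continuous_in_probability : Prop :=
  forall t, 0 <= t -> forall e : R, 0 < e ->
    P [set w | e < `|X s w - X t w|] @[s --> within [set s | 0 <= s] (nbhs t)]
      --> 0%E.

End processes.

(* The product sigma-algebra on the space of paths R_+ -> R. *)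
Definition path_cylinders (R : realType) : set_system (R -> R) :=
  [set C | exists t B, [/\ 0 <= t, measurable B & C = [set x | B (x t)]]].

Definition path_sigma_algebra (R : realType) : set_system (R -> R) :=
  <<s @path_cylinders R >>.

Definition path_event d (Omega : measurableType d) (R : realType)
    (P : probability Omega R) (X : R -> {RV P >-> R}) (A : set (R -> R)) :
  set Omega := [set w | A (fun t => X t w)].

Definition same_distribution (R : realType)
    d1 (Omega1 : measurableType d1) (P1 : probability Omega1 R)
    (X1 : R -> {RV P1 >-> R})
    d2 (Omega2 : measurableType d2) (P2 : probability Omega2 R)
    (X2 : R -> {RV P2 >-> R}) : Prop :=
  forall A, path_sigma_algebra A ->
    P1 (path_event X1 A) = P2 (path_event X2 A).

Definition independent_processes d (Omega : measurableType d) (R : realType)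
    (P : probability Omega R) (Y Z : R -> {RV P >-> R}) : Prop :=
  forall A B, path_sigma_algebra A -> path_sigma_algebra B ->
    (P (path_event Y A `&` path_event Z B) =
     P (path_event Y A) * P (path_event Z B))%E.

(* The copies Y and Z may live on any probability space.  The crossing event is
   not a priori measurable (it involves uncountably many times), hence
   "probability zero" is read as "contained in a measurable null set". *)
Definition almost_continuous d (Omega : measurableType d) (R : realType)
    (P : probability Omega R) (X : R -> {RV P >-> R}) : Prop :=
  [/\ cadlag X, continuous_in_probability X &
      forall d' (Omega' : measurableType d') (P' : probability Omega' R)
        (Y Z : R -> {RV P' >-> R}),
        cadlag Y -> cadlag Z ->
        same_distribution Y X -> same_distribution Z X ->
        independent_processes Y Z ->
        forall s t, 0 <= s -> s < t ->
          P'.-negligible [set w | [/\ Y s w < Z s w, Z t w < Y t w &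
                                   forall u, s < u -> u < t -> Y u w != Z u w]]].

Definition almost_continuous_diffusion d (Omega : measurableType d)
    (R : realType) (P : probability Omega R) (F : filtration Omega R)
    (X : R -> {RV P >-> R}) : Prop :=
  strong_markov F X /\ almost_continuous X.

(* "k <= f' <= K" *)
Definition slopes_between (R : realType) (k K : R) (f : R -> R) : Prop :=
  forall x y, x < y -> k * (y - x) <= f y - f x <= K * (y - x).

(* Main.v *)
(* Let Y, Z be two independent copies of X on the product space, filtered by the
   sets all of whose sections are in F, and let s be the first time after t at
   which Y - Z or its left limit vanishes.  Unlike the hitting time of 0, this is
   a stopping time of the uncompleted filtration.  Say Y_t <= Z_t.  Almost
   continuity forces Y_s <= Z_s, and optional stopping of the martingale Z - Y
   along the first approaches to distance 1/n shows that it cannot jump off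
   strictly when its left limit at s is 0; so Y_s = Z_s as soon as s < T.  Then
   the strong Markov property at s, applied to each section, gives Y_T and Z_T the
   same law on the event s < T, while Y_T <= Z_T on its complement.  Hence, for u
   nondecreasing, V = E[u(X_T) | F_t] is nondecreasing in X_t for almost every
   pair of points.  Applied to g(x) - k x and K x - g(x), with E[X_T | F_t] = X_t,
   this bounds the increments of V = E[g(X_T) | F_t] along X_t between those of k x
   and K x, and an essential McShane-type envelope extends V to a function of X_t
   with the same slopes. *)
Require Import Defs.
From HB Require Import structures.
From mathcomp Require Import all_boot all_order all_algebra.
From mathcomp Require Import all_classical all_reals all_analysis.
From mathcomp Require Import measurable_realfun.
From mathcomp Require Import ring lra.

Set Implicit Arguments.
Unset Strict Implicit.
Unset Printing Implicit Defensive.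

Import Order.TTheory GRing.Theory Num.Theory.
Import numFieldNormedType.Exports.

Local Open Scope classical_set_scope.
Local Open Scope ring_scope.

(** * Integration and conditional expectation *)

(** The strong Markov property is given only for stopping times of [F] and for a deterministic lag.
    The first restriction dictates the filtration on the pair: freezing one coordinate must turn a
    stopping time of the pair into one of [F]. The two coordinates can then be compared because the
    function provided by [strong_markov] depends on time and state alone, not on the stopping time.
    The second restriction is met by rounding the remaining time [T - tau] up to a grid; right
    continuity undoes the rounding, which is why test functions are continuous. Almost continuity
    speaks of two deterministic times, so a wrong order at the random meeting time has to be carried
    to a rational time just after it. Finally, monotonicity is obtained only for almost every pair
    of points: for a typical point the exceptional set depends on that point, and the extension step
    has to live with this. *)

Section integral_lemmas.
Context d (T : measurableType d) (R : realType).
Variable mu : {measure set T -> \bar R}.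

(** Restriction by zero turns the moving domains into a pointwise limit on the whole space: the two
    eventual-membership conditions say that the indicators of [A_ n] converge everywhere to that of
    [A]. Dominated convergence then applies. *)
Lemma cvg_integral_sets (f_ : nat -> T -> R) (f g : T -> R)
    (A_ : nat -> set T) (A : set T) :
  (forall n, measurable_fun setT (f_ n)) -> measurable_fun setT f ->
  (forall n, measurable (A_ n)) -> measurable A ->
  mu.-integrable setT (EFin \o g) ->
  (forall n w, A_ n w -> `|f_ n w| <= g w) ->
  (forall w, 0 <= g w) ->
  (forall w, A w -> \forall n \near \oo, A_ n w) ->
  (forall w, ~ A w -> \forall n \near \oo, ~ A_ n w) ->
  (forall w, A w -> f_ ^~ w @ \oo --> f w) ->
  (\int[mu]_(w in A_ n) (f_ n w)%:E @[n --> \oo] --> \int[mu]_(w in A) (f w)%:E)%E.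
Proof.
move=> mf_ mf mA_ mA ig fg g0 AA_ nAA_ cf.
rewrite integral_mkcond; under eq_fun do rewrite integral_mkcond.
have mr (h : T -> R) (B : set T) : measurable_fun setT h -> measurable B ->
    measurable_fun setT ((fun w => (h w)%:E) \_ B : T -> \bar R).
  move=> mh mB; apply/(measurable_restrictT _ mB).
  by apply/measurable_EFinP; exact: measurable_funTS.
have := @dominated_convergence _ _ _ mu setT measurableT
  (fun n => (fun w => (f_ n w)%:E) \_ (A_ n)) ((fun w => (f w)%:E) \_ A)
  (EFin \o g).
case=> //.
- by move=> n; exact: mr.
- exact: mr.
- apply: aeW => w _; rewrite patchE; case: ifPn => [|].
    rewrite inE => Aw; have cE : (f_ n w)%:E @[n --> \oo] --> (f w)%:E.
      by apply: cvg_EFin; [exact: nearW|exact: cf].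
    apply: cvg_trans cE; apply: near_eq_cvg.
    near=> n; rewrite patchE mem_set//; near: n; exact: AA_.
  move=> /negP; rewrite inE => nAw; apply: cvg_near_cst.
  near=> n; rewrite patchE memNset//; near: n; exact: nAA_.
- apply: aeW => w n _ /=; rewrite patchE; case: ifPn => [|_].
    by rewrite inE => /fg; rewrite lee_fin.
  by rewrite abse0 lee_fin.
Unshelve. all: by end_near.
Qed.

(** Reduces an identity at a discretised random time to the cells on which that time is constant,
    since the fibers of [k] form a countable partition of [C]. *)
Lemma eq_integral_fibers (k : T -> nat) (a b : T -> R) (C : set T) :
  measurable C -> (forall j, measurable [set w | k w = j]) ->
  mu.-integrable C (EFin \o a) -> mu.-integrable C (EFin \o b) ->
  (forall j, \int[mu]_(w in C `&` [set w | k w = j]) (a w)%:E =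
             \int[mu]_(w in C `&` [set w | k w = j]) (b w)%:E)%E ->
  (\int[mu]_(w in C) (a w)%:E = \int[mu]_(w in C) (b w)%:E)%E.
Proof.
move=> mC mk ia ib ab.
have CE : C = \bigcup_j (C `&` [set w | k w = j]).
  apply/seteqP; split => [w Cw|w [j _ []//]].
  by exists (k w).
have tC : trivIset setT (fun j => C `&` [set w | k w = j]).
  by apply/trivIsetP => i j _ _ ij; apply/seteqP; split => // w [[_ /= ->]] [_ /= ij'];
    move: ij; rewrite ij' eqxx.
have mCk j : measurable (C `&` [set w | k w = j]) by exact: measurableI.
by rewrite CE !integral_bigcup -?CE//; apply: eq_eseriesr => j _; exact: ab.
Qed.

Lemma integral_ge0_lt0_ae (f : T -> R) (C : set T) :
  measurable C -> mu.-integrable C (EFin \o f) -> (forall w, C w -> f w < 0) ->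
  (0 <= \int[mu]_(w in C) (f w)%:E)%E -> {ae mu, forall w, ~ C w}.
Proof.
move=> mC iC Cf0 intf0; have mf := measurable_int _ iC.
have : (\int[mu]_(w in C) `|(f w)%:E| = 0)%E.
  apply/eqP; rewrite eq_le integral_ge0// andbT.
  rewrite (eq_integral (fun w => - (f w)%:E)%E); last first.
    by move=> w; rewrite inE => Cw; rewrite lte0_abs// lte_fin Cf0.
  rewrite integralN/=; last first.
    apply: fin_num_adde_defl; rewrite fin_numN; apply: integrable_fin_num => //.
    exact: (integrable_funeneg mC iC).
  by rewrite leeNl oppe0.
move=> /ae_eq_integral_abs => /(_ mC mf); apply: filterS => w H Cw.
by have [] := H Cw => fw; have := Cf0 w Cw; rewrite fw ltxx.
Qed.

End integral_lemmas.

Section comparison_sets.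
Context d (T : measurableType d) (R : realType).
Implicit Types f g : T -> R.

Lemma measurable_le f g : measurable_fun setT f -> measurable_fun setT g ->
  measurable [set w | f w <= g w].
Proof.
move=> mf mg.
have := measurable_fun_ler mf mg measurableT (I : measurable [set true]).
by rewrite setTI.
Qed.

Lemma measurable_lt f g : measurable_fun setT f -> measurable_fun setT g ->
  measurable [set w | f w < g w].
Proof.
move=> mf mg.
have := measurable_fun_ltr mf mg measurableT (I : measurable [set true]).
by rewrite setTI.
Qed.

End comparison_sets.

Section filtrations.
Context d (Omega : measurableType d) (R : realType).
Variable F : filtration Omega R.

Lemma filt_measurableE t : 0 <= t ->
  (measurable : set_system (g_sigma_algebraType (F t))) = F t.
Proof. by move=> t0; apply: sigma_algebra_id; exact: filt_sigma. Qed.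

Lemma filt_measurable t A : 0 <= t ->
  F t A -> measurable (A : set (g_sigma_algebraType (F t))).
Proof. by move=> t0; rewrite filt_measurableE. Qed.

Lemma measurable_fun_filt d' (T' : measurableType d') t (f : Omega -> T') :
  0 <= t -> measurable_fun setT (f : g_sigma_algebraType (F t) -> T') ->
  measurable_fun setT f.
Proof.
move=> t0 mf _ B mB; have := mf measurableT B mB.
by rewrite filt_measurableE//; exact: filt_sub.
Qed.

Lemma measurable_fun_filt_mono d' (T' : measurableType d') s t (f : Omega -> T') :
  0 <= s -> s <= t -> measurable_fun setT (f : g_sigma_algebraType (F s) -> T') ->
  measurable_fun setT (f : g_sigma_algebraType (F t) -> T').
Proof.
move=> s0 st mf _ B mB; have := mf measurableT B mB.
by rewrite !filt_measurableE ?(le_trans s0)//; exact: filt_mono.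
Qed.

End filtrations.

Section conditional_expectation.
Context d (Omega : measurableType d) (R : realType).
Variables (P : probability Omega R) (G : set_system Omega).

(** The Radon-Nikodym derivative is taken on [Omega] equipped with the smaller sigma-algebra, so
    that it is automatically [G]-measurable. The identity map [idG] transports [P] and the charge
    with density [U] to that space. *)
Lemma condexp_exists (U : Omega -> R) :
  sigma_algebra setT G -> G `<=` measurable ->
  P.-integrable setT (EFin \o U) -> exists V, is_condexp P G U V.
Proof.
move=> sG Gm iU.
pose T' := g_sigma_algebraType G.
have mE : (measurable : set_system T') = G by apply: sigma_algebra_id.
pose idG : Omega -> T' := idfun.
have mid : measurable_fun setT idG.
  by move=> _ B; rewrite mE setTI preimage_id; exact: Gm.
pose idm := isMeasurableFun.Build _ _ Omega T' idG mid.
pose idM : {mfun Omega >-> T'} := HB.pack idG idm.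
pose nu_ : {charge set T' -> \bar R} := pushforward (induced_charge iU) idG.
pose nu := nu_ mid.
pose mu := distribution P idM.
have dom : nu `<< mu.
  apply/null_content_dominatesP => A mA A0; apply: null_set_integral => //.
  - by apply: Gm; rewrite -mE.
  - by apply: measurable_funTS; exact: measurable_int iU.
have iV := Radon_Nikodym_integrable dom.
pose V := Radon_Nikodym nu mu.
have VE w : V w = (fine (V w))%:E by rewrite fineK// Radon_Nikodym_fin_num.
have mV : measurable_fun setT (fine \o V : T' -> R).
  by apply: measurableT_comp => //; exact: measurable_int iV.
have mV' : measurable_fun setT (V : Omega -> \bar R).
  move=> _ B mB; apply: Gm; rewrite -mE.
  exact: (measurable_int _ iV).
have iV' : P.-integrable setT (V : Omega -> \bar R).
  apply/integrableP; split=> //; have /integrableP[_] := iV.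
  by rewrite ge0_integral_pushforward//; exact: measurableT_comp.
have EfV : EFin \o (fine \o V) = V by apply/funext => w /=; rewrite -VE.
exists (fine \o V); split => //.
  by rewrite EfV.
move=> A GA; have mA : measurable (A : set T') by rewrite mE.
have := Radon_Nikodym_integral dom mA.
rewrite /mu integral_pushforward//; last first.
  have mA' : measurable A by exact: Gm.
  by apply: (integrableS measurableT mA' _ iV').
move=> /esym H; rewrite -[RHS]H.
by apply: eq_integral => w _; rewrite /= -VE.
Qed.

End conditional_expectation.

(** * Stopping times of an uncompleted filtration *)

Definition cell (R : realType) (m : nat) (x : R) : nat := Num.truncn (m.+1%:R * x).

(* The least multiple of [1 / (m + 1)] that is strictly greater than [x]: right
   limits are taken along points distinct from the limit. *)
Definition grid (R : realType) (m : nat) (x : R) : R := (cell m x).+1%:R / m.+1%:R.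

Definition right_continuous_paths (R : realType) T (X : R -> T -> R) :=
  forall w t, 0 <= t -> X s w @[s --> t^'+] --> X t w.

Section grid.
Context (R : realType).
Implicit Types (m j : nat) (x : R).

Lemma cell_eq m j x : 0 <= x ->
  (cell m x == j) = (j%:R / m.+1%:R <= x < j.+1%:R / m.+1%:R).
Proof.
by move=> x0; rewrite /cell truncn_eq ?mulr_ge0// ler_pdivrMr// ltr_pdivlMr// mulrC.
Qed.

Lemma lt_grid m x : x < grid m x.
Proof. by rewrite /grid ltr_pdivlMr// mulrC truncnS_gt. Qed.

Lemma grid_le m x : 0 <= x -> grid m x <= x + m.+1%:R^-1.
Proof.
move=> x0; rewrite /grid -natr1 mulrDl mul1r lerD2r.
by have /andP[] : _ && _ := etrans (esym (cell_eq m (cell m x) x0)) (eqxx _).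
Qed.

Lemma cvg_grid x : 0 <= x -> grid m x @[m --> \oo] --> x.
Proof.
move=> x0; apply: (@squeeze_cvgr _ _ _ _ (cst x) (fun m => x + m.+1%:R^-1)).
- by apply: nearW => m; rewrite (ltW (lt_grid _ _)) grid_le.
- exact: cvg_cst.
- by rewrite -[X in _ --> X]addr0; apply: cvgD; [exact: cvg_cst|exact: cvg_harmonic].
Qed.

Lemma right_continuous_grid T (X : R -> T -> R) w x : right_continuous_paths X ->
  0 <= x -> X (grid m x) w @[m --> \oo] --> X x w.
Proof.
move=> rX x0; have /cvg_at_rightP := rX w x x0; apply.
by split; [move=> m; exact: lt_grid|exact: cvg_grid].
Qed.

Context d (T : measurableType d).

Lemma measurable_cell m (rho : T -> R) j : measurable_fun setT rho ->
  (forall w, 0 <= rho w) -> measurable [set w | cell m (rho w) = j].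
Proof.
move=> mrho rho0.
rewrite (_ : mkset _ = rho @^-1` `[j%:R / m.+1%:R, j.+1%:R / m.+1%:R[%classic).
  by rewrite -[X in measurable X]setTI; exact: mrho.
by apply/seteqP; split => w /=; rewrite in_itv/= -cell_eq// => /eqP.
Qed.

(** This is progressive measurability: capping the grid times at [u] keeps every sampled time in
    [0, u], so [T] may carry the sigma-algebra of events known at time [u]. Where [rho w = u] the
    capped times are constant; elsewhere the cap is eventually inactive. *)
Lemma measurable_at_time (X : R -> T -> R) (u : R) (rho : T -> R) :
  right_continuous_paths X ->
  (forall s, 0 <= s -> s <= u -> measurable_fun setT (X s)) ->
  measurable_fun setT rho -> (forall w, 0 <= rho w <= u) ->
  measurable_fun setT (fun w => X (rho w) w).
Proof.
move=> rX mX mrho rho0u.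
have rho0 w : 0 <= rho w by case/andP: (rho0u w).
apply: (@measurable_fun_cvg _ _ _ setT
  (fun m w => X (Num.min u (grid m (rho w))) w)).
  move=> m _ B mB; rewrite setTI.
  rewrite (_ : _ @^-1` _ = \bigcup_j ([set w | cell m (rho w) = j] `&`
      (X (Num.min u (j.+1%:R / m.+1%:R)) @^-1` B))); last first.
    apply/seteqP; split => [w Bw|w [j _ []/= <-//]].
    by exists (cell m (rho w)).
  apply: bigcupT_measurable => j.
  (* A point of [T] is what provides [0 <= u]. *)
  have [ne|e] := pselect (exists w : T, True); last first.
    rewrite (_ : _ `&` _ = set0)//; apply/seteqP; split => // w _.
    by apply: e; exists w.
  case: ne => w0 _; have u0 : 0 <= u by case/andP: (rho0u w0); exact: le_trans.
  apply: measurableI; first exact: measurable_cell.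
  rewrite -[X in measurable X]setTI; apply: mX => //.
    by rewrite le_min u0 divr_ge0.
  by rewrite ge_min lexx.
move=> w _; have /andP[_] := rho0u w; rewrite le_eqVlt => /predU1P[->|ru].
  apply: cvg_near_cst; apply: nearW => m.
  by rewrite min_l// ltW// lt_grid.
apply: (cvg_trans _ (right_continuous_grid rX (rho0 w))).
apply: near_eq_cvg; near=> m; rewrite min_r// ltW//; near: m.
by apply: (cvgr_lt _ (cvg_grid (rho0 w))).
Unshelve. all: by end_near. Qed.

End grid.

Section stopping.
Context d (Omega : measurableType d) (R : realType).
Variable F : filtration Omega R.
Implicit Types (tau : Omega -> R) (t u : R) (A B : set Omega).

Lemma measurable_fun_le_rays d' (T : measurableType d') (f : T -> R) :
  (forall c, measurable [set w | f w <= c]) -> measurable_fun setT f.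
Proof.
move=> mf; apply: (measurability _ (RGenOInfty.measurableE R)) => //.
move=> _ [_ [a ->] <-]; rewrite setTI.
rewrite (_ : _ @^-1` _ = ~` [set w | f w <= a]); first exact: measurableC.
by apply/seteqP; split => w /=; rewrite in_itv/= andbT ltNge => /negP.
Qed.

Lemma filt_setT t : 0 <= t -> F t setT.
Proof. by move=> t0; rewrite -filt_measurableE//; exact: measurableT. Qed.

Lemma filt_setI t A B : 0 <= t -> F t A -> F t B -> F t (A `&` B).
Proof. by move=> t0; rewrite -filt_measurableE//; exact: measurableI. Qed.

Lemma filt_setD t A B : 0 <= t -> F t A -> F t B -> F t (A `\` B).
Proof. by move=> t0; rewrite -filt_measurableE//; exact: measurableD. Qed.

(** The capped time is known at [u] and agrees with [tau] on the event [tau w <= u]; membership in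
    the stopped sigma-algebra is checked through it. *)
Lemma stopping_min tau u : finite_stopping_time F tau -> 0 <= u ->
  measurable_fun setT
    ((fun w => Num.min u (tau w)) : g_sigma_algebraType (F u) -> R).
Proof.
move=> [tau0 Ftau] u0; apply: measurable_fun_le_rays => c.
rewrite filt_measurableE//; have [uc|cu] := leP u c.
  rewrite (_ : mkset _ = setT); first exact: filt_setT.
  by apply/seteqP; split => // w _ /=; rewrite ge_min uc.
rewrite (_ : mkset _ = [set w | tau w <= c]); last first.
  by apply/seteqP; split => w /=; rewrite ge_min leNgt cu.
have [c0|c0] := leP 0 c; first exact: (filt_mono c0 (ltW cu) (Ftau _ c0)).
rewrite (_ : mkset _ = set0); last first.
  apply/seteqP; split => // w /=; apply/negP; rewrite -ltNge.
  exact: lt_le_trans (tau0 w).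
by rewrite -filt_measurableE//; exact: measurable0.
Qed.

Lemma stopping_measurable tau : finite_stopping_time F tau ->
  measurable_fun setT tau.
Proof.
move=> [tau0 Ftau]; apply: measurable_fun_le_rays => c.
have [c0|c0] := leP 0 c; first exact: (filt_sub c0 (Ftau _ c0)).
rewrite (_ : mkset _ = set0)//; apply/seteqP; split => // w /=.
by apply/negP; rewrite -ltNge; exact: lt_le_trans (tau0 w).
Qed.

Lemma stopped_setI tau A B : stopped_sigma_algebra F tau A ->
  stopped_sigma_algebra F tau B -> stopped_sigma_algebra F tau (A `&` B).
Proof.
move=> [mA FA] [mB FB]; split; first exact: measurableI.
by move=> t t0; rewrite setIIl; apply: filt_setI => //; [exact: FA|exact: FB].
Qed.

Lemma stopped_preimage tau (B : set R) : finite_stopping_time F tau ->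
  measurable B -> stopped_sigma_algebra F tau (tau @^-1` B).
Proof.
move=> stau mB; split.
  by rewrite -[X in measurable X]setTI; exact: stopping_measurable.
move=> t t0; rewrite (_ : _ `&` _ =
    ((fun w => Num.min t (tau w)) @^-1` B) `&` [set w | tau w <= t]).
  apply: filt_setI => //; last by apply stau.2.
  by rewrite -filt_measurableE// -[X in measurable X]setTI; exact: stopping_min.
by apply/seteqP; split => w /= [Bw wt]; move: Bw; rewrite min_r.
Qed.

Lemma stopped_filt tau t A : 0 <= t -> finite_stopping_time F tau ->
  (forall w, t <= tau w) -> F t A -> stopped_sigma_algebra F tau A.
Proof.
move=> t0 stau ttau FA; split; first exact: (filt_sub t0 FA).
move=> u u0; have [tu|ut] := leP t u.
  by apply: filt_setI => //; [exact: (filt_mono t0 tu FA)|exact: stau.2].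
rewrite (_ : _ `&` _ = set0); last first.
  apply/seteqP; split => // w /= [_]; apply/negP; rewrite -ltNge.
  exact: lt_le_trans (ttau w).
by rewrite -filt_measurableE//; exact: measurable0.
Qed.

Lemma stopped_mono tau tau' A : finite_stopping_time F tau' ->
  (forall w, tau w <= tau' w) -> stopped_sigma_algebra F tau A ->
  stopped_sigma_algebra F tau' A.
Proof.
move=> stau' tt' [mA FA]; split=> // t t0.
rewrite (_ : _ `&` _ = (A `&` [set w | tau w <= t]) `&` [set w | tau' w <= t]).
  by apply: filt_setI => //; [exact: FA|exact: stau'.2].
apply/seteqP; split => w /= [] => [Aw wt|[Aw _] wt]//.
by split => //; split => //; exact: le_trans wt.
Qed.

Definition adapted_to (X : R -> Omega -> R) := forall t, 0 <= t ->
  measurable_fun setT (X t : g_sigma_algebraType (F t) -> R).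

Lemma stopped_process (X : R -> Omega -> R) tau u (B : set R) :
  adapted_to X -> right_continuous_paths X ->
  finite_stopping_time F tau -> (forall w, tau w <= u) ->
  measurable B -> stopped_sigma_algebra F tau [set w | B (X (tau w) w)].
Proof.
move=> aX rX stau tauu mB; split.
  rewrite -[X in measurable X]setTI.
  apply: (@measurable_at_time _ _ _ X u tau) => //.
  - by move=> s s0 _; exact: measurable_fun_filt s0 (aX s s0).
  - exact: stopping_measurable.
  - by move=> w; rewrite tauu stau.1.
move=> t t0; rewrite (_ : _ `&` _ =
    ((fun w => X (Num.min t (tau w)) w) @^-1` B) `&` [set w | tau w <= t]).
  apply: filt_setI => //; last by apply stau.2.
  rewrite -filt_measurableE// -[X in measurable X]setTI.
  apply: (@measurable_at_time _ _ (g_sigma_algebraType (F t)) X t) => //.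
  - by move=> s s0 st; exact: measurable_fun_filt_mono s0 st (aX s s0).
  - exact: stopping_min.
  - by move=> w; rewrite ge_min lexx le_min t0 stau.1.
by apply/seteqP; split => w /= [Bw wt]; move: Bw; rewrite min_r.
Qed.

End stopping.

(** * Optional stopping for right-continuous martingales *)

Section optional_stopping.
Context d (Omega : measurableType d) (R : realType).
Variables (P : probability Omega R) (F : filtration Omega R).
Variable M : R -> Omega -> R.
Hypotheses (aM : adapted_to F M) (rM : right_continuous_paths M).
Hypothesis iM : forall t, 0 <= t -> P.-integrable setT (EFin \o M t).
Hypothesis EM : forall s t A, 0 <= s -> s <= t -> F s A ->
  (\int[P]_(w in A) (M s w)%:E = \int[P]_(w in A) (M t w)%:E)%E.

(** Grid times just above [tau] take countably many values, so the martingale identity holds cell by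
    cell, and right continuity gives the limit. The bound [c] on [C], relaxed to [c + 1] at the grid
    times, supplies a constant dominating function in place of a uniform integrability argument.
    Grid times may overshoot [T] by up to 1, whence the terminal time [T + 1]. *)
Lemma optional_stopping (tau : Omega -> R) (T c : R) (C : set Omega) :
  finite_stopping_time F tau -> (forall w, tau w <= T) ->
  stopped_sigma_algebra F tau C -> (forall w, C w -> `|M (tau w) w| <= c) ->
  (\int[P]_(w in C) (M (tau w) w)%:E = \int[P]_(w in C) (M (T + 1) w)%:E)%E.
Proof.
move=> stau tauT FC Mc; have tau0 := stau.1.
have [Ce|/set0P[w0 Cw0]] := eqVneq C set0; first by rewrite Ce !integral_set0.
have T0 : 0 <= T by apply: le_trans (tauT w0).
have T10 : 0 <= T + 1 by rewrite addr_ge0.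
have mtau := stopping_measurable stau.
have mM t : 0 <= t -> measurable_fun setT (M t).
  by move=> t0; exact: measurable_fun_filt t0 (aM t0).
have gT m w : grid m (tau w) <= T + 1.
  apply: le_trans (grid_le _ (tau0 w)) _; rewrite lerD//.
  by rewrite invf_le1// ler1n.
have gE m w : grid m (tau w) = (cell m (tau w)).+1%:R / m.+1%:R by [].
have mMg m : measurable_fun setT (fun w => M (grid m (tau w)) w).
  apply: (@measurable_at_time _ _ _ M (T + 1)) => //.
  - by move=> s s0 _; exact: mM.
  - move=> _ B mB; rewrite setTI; rewrite (_ : _ @^-1` _ =
      \bigcup_(j in [set j | B (j.+1%:R / m.+1%:R)])
        [set w | cell m (tau w) = j]).
      by apply: bigcup_measurable => j _; exact: measurable_cell.
    apply/seteqP; split => [w Bw|w [j Bj] /= jE]; first by exists (cell m (tau w)).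
    by rewrite /grid jE.
  - by move=> w; rewrite gT andbT (le_trans (tau0 w))// ltW// lt_grid.
have mMt : measurable_fun setT (fun w => M (tau w) w).
  apply: (@measurable_at_time _ _ _ M (T + 1)) => //.
  - by move=> s s0 _; exact: mM.
  - by move=> w; rewrite tau0 (le_trans (tauT w))// lerDl.
pose C_ m := C `&` [set w | `|M (grid m (tau w)) w| <= c + 1].
have mC : measurable C by case: FC.
have mC_ m : measurable (C_ m).
  by apply: measurableI => //; apply: measurable_le => //; exact: measurableT_comp.
have c0 : 0 <= c by apply: le_trans (Mc _ Cw0).
have nearC w : C w -> \forall m \near \oo, C_ m w.
  move=> Cw; have Mcw : `|M (tau w) w| < c + 1.
    by rewrite (le_lt_trans (Mc _ Cw))// ltrDl.
  have /cvg_norm /cvgr_lt := right_continuous_grid (w := w) rM (tau0 w).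
  move=> /(_ _ Mcw); apply: filterS => m mc; split => //=; exact: ltW.
have nnearC w : ~ C w -> \forall m \near \oo, ~ C_ m w.
  by move=> nCw; apply: nearW => m [].
have EC m : (\int[P]_(w in C_ m) (M (grid m (tau w)) w)%:E =
             \int[P]_(w in C_ m) (M (T + 1) w)%:E)%E.
  apply: (@eq_integral_fibers _ _ _ _ (fun w => cell m (tau w))) => //.
  - by move=> j; exact: measurable_cell.
  - apply: measurable_bounded_integrable => //.
    + by rewrite (le_lt_trans (probability_le1 _ _))// ltry.
    + exact: measurable_funTS.
    + exists (c + 1); split; first by rewrite num_real.
      by move=> x cx w [_ /= Mw]; rewrite (le_trans Mw)// ltW.
    exact: (integrableS measurableT (mC_ m) (@subsetT _ _) (iM T10)).
  (* Only a point in the cell guarantees that its right endpoint [v] is at most [T + 1]; an empty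
     cell contributes nothing. *)
  move=> j; have [ex|nex] := pselect (exists w, cell m (tau w) = j); last first.
    rewrite (_ : _ `&` _ = set0) ?integral_set0//.
    apply/seteqP; split => // w [_ /= wj].
    by apply: nex; exists w.
  pose v : R := j.+1%:R / m.+1%:R.
  have v0 : 0 <= v by rewrite divr_ge0.
  have vT : v <= T + 1 by case: ex => w wj; rewrite /v -wj -gE.
  (* On the cell the grid time is the constant [v], which lies to the right of the cell: both the
     cell and the bound on [M v] are therefore known at time [v]. *)
  rewrite -(EM v0 vT); last first.
    rewrite (_ : _ `&` _ =
       ((C `&` tau @^-1` `[j%:R / m.+1%:R, j.+1%:R / m.+1%:R[%classic)
        `&` [set w | tau w <= v])
       `&` (M v @^-1` [set x | `|x| <= c + 1])).
      apply: filt_setI => //.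
        have [_] := stopped_setI FC (stopped_preimage stau
          (measurable_itv `[j%:R / m.+1%:R, j.+1%:R / m.+1%:R[)).
        by apply.
      rewrite -filt_measurableE// -[X in measurable X]setTI; apply: aM => //.
      rewrite (_ : mkset _ = `[(- (c + 1)), (c + 1)]%classic)//.
      by apply/seteqP; split => x /=; rewrite in_itv/= ler_norml.
    apply/seteqP; split => [w [[Cw Mw] /= wj]|w [[[Cw wj] _] Mw]].
      have := eqxx j; rewrite -{1}wj cell_eq// => jE.
      split; last by move: Mw; rewrite /= gE wj.
      split; first by split => //; rewrite /= in_itv.
      by case/andP: jE => _ /ltW.
    have wj' : cell m (tau w) = j.
      by apply/eqP; rewrite cell_eq//; move: wj; rewrite /= in_itv.
    by split => //; split => //=; rewrite gE wj'.
  apply: eq_integral => w; rewrite inE => -[_ /= wj]; by rewrite gE wj.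
have lhs : (\int[P]_(w in C_ m) (M (grid m (tau w)) w)%:E @[m --> \oo] -->
    \int[P]_(w in C) (M (tau w) w)%:E)%E.
  apply: (@cvg_integral_sets _ _ _ _ _ _ (cst (c + 1))) => //.
  - exact: finite_measure_integrable_cst.
  - by move=> m w [].
  - by move=> w /=; rewrite addr_ge0.
  - by move=> w Cw; apply: right_continuous_grid.
have rhs : (\int[P]_(w in C_ m) (M (T + 1) w)%:E @[m --> \oo] -->
    \int[P]_(w in C) (M (T + 1) w)%:E)%E.
  apply: (@cvg_integral_sets _ _ _ _ _ _ (fun w => `|M (T + 1) w|)) => //.
  - by move=> _; exact: mM.
  - exact: mM.
  - by have := integrable_abse (iM T10).
  - by move=> w Cw; exact: cvg_cst.
rewrite -(cvg_lim _ lhs)// -(cvg_lim _ rhs)//.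
by congr (lim (_ @ \oo)); apply/funext => m; exact: EC.
Qed.

End optional_stopping.

(** * Approaching zero *)

Lemma near_rightE (R : realType) (p : R) (Q : R -> Prop) :
  (\forall x \near p^'+, Q x) ->
  exists2 e, 0 < e & forall x, p < x < p + e -> Q x.
Proof.
case=> e /= e0 H; exists e => // x /andP[px xe]; apply: H => //=.
by rewrite ltr0_norm ?subr_lt0// opprB ltrBlDl.
Qed.

Lemma near_leftE (R : realType) (p : R) (Q : R -> Prop) :
  (\forall x \near p^'-, Q x) ->
  exists2 e, 0 < e & forall x, p - e < x < p -> Q x.
Proof.
case=> e /= e0 H; exists e => // x /andP[xe xp]; apply: H => //=.
by rewrite gtr0_norm ?subr_gt0// ltrBlDl -ltrBlDr.
Qed.

Section hitting_path.
Context (R : realType).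
Variables (D : R -> R) (t T : R).

(* The infimum of [|D|] over [t, u] is at most [a]; for a cadlag [D] this means that
   [|D|] or its left limit takes a value at most [a]. *)
Definition approached (a u : R) : Prop :=
  forall m : nat, exists q, [/\ t <= q, q <= u & `|D q| < a + m.+1%:R^-1].

(** Adding [T] caps the time and keeps the set nonempty; the value is [T] also when no approach
    occurs before [T]. *)
Definition hit (a : R) : R :=
  inf ([set u | [/\ t <= u, u < T & approached a u]] `|` [set T]).

Hypotheses (t0 : 0 <= t) (tT : t < T).
Hypothesis rD : forall s, 0 <= s -> D x @[x --> s^'+] --> D s.

Lemma approachedW (a b u v : R) : a <= b -> u <= v ->
  approached a u -> approached b v.
Proof.
move=> ab uv H m; have [q [tq qu Dq]] := H m; exists q; split => //.
  exact: le_trans uv.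
by rewrite (lt_le_trans Dq)// lerD2r.
Qed.

Lemma hit_has_inf a :
  has_inf ([set u | [/\ t <= u, u < T & approached a u]] `|` [set T]).
Proof.
split; first by exists T; right.
by exists t => u [[]//|->]; exact: ltW.
Qed.

Lemma hit_ge a : t <= hit a.
Proof.
apply: lb_le_inf; first by exists T; right.
by move=> u [[]//|->]; exact: ltW.
Qed.

Lemma hit_le a : hit a <= T.
Proof. by apply: ge_inf; [exact: (hit_has_inf a).2|right]. Qed.

(** The infimum is attained thanks to right continuity: if [|D u|] is not already small, then [|D|]
    stays bounded below just after [u], so the witnesses of an approach completed shortly after [u]
    must lie at or before [u]. *)
Lemma hit_leP a u : t <= u -> u < T -> (hit a <= u) <-> approached a u.
Proof.
move=> tu uT; split; last first.
  by move=> au; apply: ge_inf; [exact: (hit_has_inf a).2|left].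
move=> hu m; have [Du|Du] := ltP `|D u| (a + m.+1%:R^-1).
  by exists u.
(* Passing from index [m] to [m.+1] creates the strict gap that survives on a right neighbourhood of
   [u]. *)
have lt1 : a + m.+2%:R^-1 < `|D u|.
  by apply: lt_le_trans Du; rewrite ltrD2l ltf_pV2 ?posrE ?ltr0n// ltr_nat.
have u0 : 0 <= u by exact: le_trans tu.
have /cvg_norm /cvgr_gt /(_ _ lt1) /near_rightE[e e0 He] := rD u0.
have [u' [|] ] : exists2 u',
    ([set u | [/\ t <= u, u < T & approached a u]] `|` [set T]) u' &
    u' < Num.min T (u + e).
- apply: inf_lt; first by exists T; right.
  by rewrite (le_lt_trans hu)// lt_min uT ltrDl.
- move=> [tu' u'T au']; rewrite lt_min => /andP[_ u'e].
  have [q [tq qu' Dq]] := au' m.+1; have [qu|uq] := leP q u.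
    exists q; split => //; rewrite (lt_trans Dq)// ltrD2l.
    by rewrite ltf_pV2 ?posrE ?ltr0n// ltr_nat.
  have := He q; rewrite uq (le_lt_trans qu' u'e) => /(_ isT).
  by move=> /(lt_trans Dq); rewrite ltxx.
- by move=> ->; rewrite lt_min ltxx.
Qed.

Lemma hit_anti a b : a <= b -> hit b <= hit a.
Proof.
move=> ab; have := hit_le a; rewrite le_eqVlt => /predU1P[->|haT].
  exact: hit_le.
apply/hit_leP => //; first exact: hit_ge.
by have /approachedW := (hit_leP a (hit_ge a) haT).1 (lexx _); apply.
Qed.

Lemma hit_eq0 u : t <= u -> u < T -> D u = 0 -> hit 0 <= u.
Proof.
move=> tu uT Du; apply/hit_leP => // m; exists u; split => //.
by rewrite Du normr0 add0r invr_gt0.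
Qed.

Let hn (n : nat) := hit n.+1%:R^-1.

(** If [D] does not vanish at [hit 0], its small values are taken strictly earlier, and each of them
    already realises an approach to level 1/(n+1). *)
Lemma hit_lt0 n : hit 0 < T -> D (hit 0) != 0 -> hn n < hit 0.
Proof.
move=> h0T Dh; have ap := (hit_leP 0 (hit_ge 0) h0T).1 (lexx _).
have nD : 0 < `|D (hit 0)| by rewrite normr_gt0.
(* The first argument makes the witness [q] reach level 1/(n+1); the second makes 1/(m+1) at most
   [|D (hit 0)|], which excludes [q = hit 0]. *)
pose m := maxn n (Num.truncn `|D (hit 0)|^-1).
have [q [tq qh Dq]] := ap m; move: Dq; rewrite add0r => Dq.
have qn : q != hit 0.
  apply/eqP => qE; move: Dq; rewrite qE ltNge => /negP; apply.
  rewrite invf_ple ?posrE// ltW// (lt_le_trans (truncnS_gt _))// ler_nat.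
  by rewrite ltnS leq_maxr.
have {qn}qlt : q < hit 0 by rewrite lt_neqAle qn.
apply: le_lt_trans qlt; apply/hit_leP => //.
  exact: le_lt_trans h0T.
move=> k; exists q; split => //; rewrite (lt_le_trans Dq)//.
apply: (@le_trans _ _ n.+1%:R^-1); last by rewrite lerDl invr_ge0.
by rewrite lef_pV2 ?posrE ?ltr0n// ler_nat ltnS leq_maxl.
Qed.

Hypothesis lD : forall s, 0 < s -> cvg (D x @[x --> s^'-]).

(** The value [D (hn n)] need not be within 1/(n+1) of 0, as the level may be reached by a left
    limit only. Instead, [hn n] tends to [hit 0] strictly from the left, so [D (hn n)] tends to the
    left limit there. A nonzero left limit would keep [|D|] away from 0 on the whole of [t,
    [hit 0]). *)
Lemma hit_cvg0 : (forall n, hn n < hit 0) -> D (hn n) @[n --> \oo] --> 0.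
Proof.
move=> hlt.
have away u : t <= u -> u < hit 0 -> exists n0 : nat,
    (forall q, t <= q -> q <= u -> n0.+1%:R^-1 <= `|D q|).
  move=> tu uh; have uT : u < T by apply: lt_le_trans uh (hit_le _).
  apply: contrapT => nex; move: uh; rewrite ltNge => /negP; apply.
  apply/hit_leP => // m; rewrite add0r; apply: contrapT => nq.
  apply: nex; exists m => q tq qu; rewrite leNgt; apply/negP => Dq.
  by apply: nq; exists q.
have hlate u : u < hit 0 -> \forall n \near \oo, u < hn n.
  move=> uh; have [ut|tu] := ltP u t.
    by apply: nearW => n; exact: lt_le_trans (hit_ge _).
  have [n0 an0] := away u tu uh.
  (* Approach to level 1/(n+1), tested at index [n], gives a value below 2/(n+1); doubling absorbs
     this factor 2. *)
  exists (n0.+1).*2 => // n /= nn; rewrite ltNge; apply/negP => /hit_leP.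
  have uT : u < T by apply: lt_le_trans uh (hit_le _).
  move=> /(_ tu uT) /(_ n)[q [tq qu]]; apply/negP; rewrite -leNgt.
  rewrite (le_trans _ (an0 _ tq qu))//.
  have -> : n0.+1%:R^-1 = (n0.+1).*2%:R^-1 + (n0.+1).*2%:R^-1 :> R.
    have n0P : n0.+1%:R != 0 :> R by rewrite pnatr_eq0.
    by rewrite -mul2n natrM; field.
  by rewrite lerD// lef_pV2 ?posrE ?ltr0n ?double_gt0// ler_nat (leq_trans nn).
have th : t < hit 0 by apply: le_lt_trans (hlt 0); exact: hit_ge.
have h0 : 0 < hit 0 by apply: le_lt_trans th.
have /cvg_ex[L DL] := lD h0.
have hcvg : hn n @[n --> \oo] --> hit 0.
  apply/cvgrPdist_lt => e e0; near=> n.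
  rewrite ger0_norm ?subr_ge0; last exact/ltW/hlt.
  by rewrite ltrBlDl -ltrBlDr; near: n; apply: hlate; rewrite ltrBlDr ltrDl.
have DhL : D (hn n) @[n --> \oo] --> L.
  by have /cvg_at_leftP := DL; apply; split.
suff L0 : L = 0 by rewrite -L0.
apply: contrapT => /eqP; rewrite -normr_gt0 => L0.
have L2 : `|L| / 2 < `|L| by lra.
have /cvg_norm /cvgr_gt /(_ _ L2) /near_leftE[e e0 He] := DL.
pose u := Num.max t (hit 0 - e / 2).
have uh : u < hit 0 by rewrite /u gt_max th ltrBlDr ltrDl; lra.
have tu : t <= u by rewrite le_max lexx.
have [n0 an0] := away u tu uh.
have c0 : 0 < Num.min n0.+1%:R^-1 (`|L| / 2) :> R.
  by rewrite lt_min invr_gt0 ltr0n/= divr_gt0.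
(* Makes 2/(n+1) at most both lower bounds of [|D|]: the one valid up to [u] and the one, [|L| / 2],
   valid between [u] and [hit 0]. *)
pose n := Num.truncn (2 / Num.min n0.+1%:R^-1 (`|L| / 2) : R).
have hnT : hn n < T by apply: lt_le_trans (hlt n) (hit_le _).
have [q [tq qh Dq]] := (hit_leP _ (hit_ge _) hnT).1 (lexx _) n.
have Dq2 : `|D q| < Num.min n0.+1%:R^-1 (`|L| / 2).
  apply: lt_le_trans Dq _; rewrite -mulr2n -[_ *+ 2]mulr_natl ler_pdivrMr ?ltr0n//.
  by rewrite mulrC -ler_pdivrMr// ltW// truncnS_gt.
move: Dq2; rewrite lt_min => /andP[Dq2 Dq3].
have [qu|uq] := leP q u.
  by have := an0 _ tq qu; rewrite leNgt Dq2.
have := He q; rewrite (le_lt_trans qh (hlt n)) andbT.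
have -> : hit 0 - e < q.
  apply: lt_trans uq; rewrite /u lt_max; apply/orP; right.
  by rewrite ltrD2l ltrN2; lra.
by move=> /(_ isT); rewrite ltNge (ltW Dq3).
Unshelve. all: by end_near. Qed.

(** Right continuity moves a witness before [u] to a rational one. The endpoint [u] has no room to
    its right within [t, u]; clamping lets any rational beyond [u] stand for it. *)
Lemma hit_approach_rat a u : t <= u -> approached a u <->
  forall m : nat, exists q : rat,
    `|D (Num.max t (Num.min u (ratr q)))| < a + m.+1%:R^-1.
Proof.
move=> tu; split => H m; last first.
  have [q Dq] := H m; exists (Num.max t (Num.min u (ratr q))); split => //.
    by rewrite le_max lexx.
  by rewrite ge_max tu ge_min lexx.
have [q [tq qu Dq]] := H m; move: qu; rewrite le_eqVlt => /predU1P[qE|qu].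
  have [r] := rat_in_itvoo (ltr_pwDr ltr01 (lexx u) : u < u + 1).
  rewrite in_itv/= => /andP[ur _]; exists r.
  by rewrite min_l ?ltW// max_r// -qE.
have q0 : 0 <= q by exact: le_trans tq.
have /cvg_norm /cvgr_lt /(_ _ Dq) /near_rightE[e e0 He] := rD q0.
have [r] : exists r, ratr r \in `]q, Num.min u (q + e)[.
  by apply: rat_in_itvoo; rewrite lt_min qu ltrDl.
rewrite in_itv/= lt_min => /and3P[qr ru re]; exists r.
rewrite min_r ?ltW// max_r ?(le_trans tq) ?ltW//.
by apply: He; rewrite qr.
Qed.

End hitting_path.

Section hitting_time.
Context d (Omega : measurableType d) (R : realType).
Variables (F : filtration Omega R) (D : R -> Omega -> R) (t T : R).
Hypotheses (t0 : 0 <= t) (tT : t < T).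
Hypotheses (aD : adapted_to F D) (rD : right_continuous_paths D).

(** The event reads [D] at countably many times in [t, u] only, so it lies in [F u] itself rather
    than in a completion or in an intersection of later sigma-algebras. *)
Lemma hit_stopping a :
  finite_stopping_time F (fun w => hit (D ^~ w) t T a).
Proof.
split=> [w|u u0]; first by rewrite (le_trans t0)// hit_ge.
have [Tu|uT] := leP T u.
  rewrite (_ : mkset _ = setT); first exact: filt_setT.
  by apply/seteqP; split => // w _ /=; rewrite (le_trans (hit_le _ _ _)).
have [tu|ut] := leP t u; last first.
  rewrite (_ : mkset _ = set0).
    by rewrite -filt_measurableE//; exact: measurable0.
  apply/seteqP; split => // w /=; apply/negP; rewrite -ltNge.
  exact: lt_le_trans (hit_ge _ _ _).
rewrite (_ : mkset _ = \bigcap_(m : nat) \bigcup_(q : rat)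
  [set w | `|D (Num.max t (Num.min u (ratr q))) w| < a + m.+1%:R^-1]); last first.
  have rDw w s : 0 <= s -> D x w @[x --> s^'+] --> D s w by exact: rD.
  have E w : hit (D ^~ w) t T a <= u <-> forall m : nat, exists q : rat,
      `|D (Num.max t (Num.min u (ratr q))) w| < a + m.+1%:R^-1.
    apply: iff_trans; first by apply: hit_leP => //; exact: rDw.
    by apply: hit_approach_rat => //; exact: rDw.
  apply/seteqP; split => [w /= /E hu m _|w H /=].
    by have [q Dq] := hu m; exists q.
  by apply/E => m; have [q _ Dq] := H m I; exists q.
rewrite -filt_measurableE//; apply: bigcapT_measurable => m.
apply: bigcupT_measurable_rat => q.
set s := Num.max _ _.
have s0 : 0 <= s by rewrite le_max t0.
have su : s <= u by rewrite ge_max tu ge_min lexx.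
apply: (@measurable_lt _ (g_sigma_algebraType (F u))); last exact: measurable_cst.
by apply: measurableT_comp => //; exact: measurable_fun_filt_mono s0 su (aD s0).
Qed.

End hitting_time.

Section stopped_sigma.
Context d (Omega : measurableType d) (R : realType).
Variable F : filtration Omega R.

Lemma sigma_algebra_stopped tau : finite_stopping_time F tau ->
  sigma_algebra setT (stopped_sigma_algebra F tau).
Proof.
move=> stau; split.
- split=> [|t t0]; first exact: measurable0.
  by rewrite set0I -filt_measurableE//; exact: measurable0.
- move=> A [mA FA]; split=> [|t t0]; first exact: measurableD.
  rewrite (_ : _ `&` _ = [set w | tau w <= t] `\` (A `&` [set w | tau w <= t])).
    by apply: filt_setD => //; [exact: stau.2|exact: FA].
  apply/seteqP; split => [w [[_ nAw] wt]|w [wt nAw]]; split => //.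
  - by move=> [].
  - by split => // Aw; exact: nAw.
- move=> A FA; split=> [|t t0].
    by apply: bigcupT_measurable => n; have [] := FA n.
  rewrite setI_bigcupl -filt_measurableE//; apply: bigcupT_measurable => n.
  by apply: filt_measurable => //; exact: (FA n).2.
Qed.

Lemma stopped_measurableE tau : finite_stopping_time F tau ->
  (measurable : set_system (g_sigma_algebraType (stopped_sigma_algebra F tau)))
  = stopped_sigma_algebra F tau.
Proof. by move=> stau; apply: sigma_algebra_id; exact: sigma_algebra_stopped. Qed.

End stopped_sigma.

(** * A martingale at its first approach to zero *)

Section meeting.
Context d (Omega : measurableType d) (R : realType).
Variables (P : probability Omega R) (F : filtration Omega R).
Variables (D : R -> Omega -> R) (t T : R).
Hypotheses (t0 : 0 <= t) (tT : t < T).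
Hypotheses (aD : adapted_to F D) (rD : right_continuous_paths D).
Hypothesis lD : forall w s, 0 < s -> cvg (D x w @[x --> s^'-]).
Hypothesis iD : forall t, 0 <= t -> P.-integrable setT (EFin \o D t).
Hypothesis ED : forall s t A, 0 <= s -> s <= t -> F s A ->
  (\int[P]_(w in A) (D s w)%:E = \int[P]_(w in A) (D t w)%:E)%E.

Let sig w := hit (D ^~ w) t T 0.
Let sign n w := hit (D ^~ w) t T n.+1%:R^-1.

Hypothesis nocross : {ae P, forall w, 0 <= D t w -> 0 <= D (sig w) w}.

Let rDw w s : 0 <= s -> D x w @[x --> s^'+] --> D s w. Proof. exact: rD. Qed.

Let ssig : finite_stopping_time F sig. Proof. exact: hit_stopping. Qed.

Let ssign n : finite_stopping_time F (sign n). Proof. exact: hit_stopping. Qed.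

Let sigT w : sig w <= T. Proof. exact: hit_le. Qed.

Let signT n w : sign n w <= T. Proof. exact: hit_le. Qed.

Let sign_sig n w : sign n w <= sig w.
Proof. by apply: (hit_anti t0 tT (@rDw w)); rewrite invr_ge0. Qed.

Let B := [set w | 0 <= D t w].

Let FB : F t B.
Proof.
rewrite -filt_measurableE//.
exact: (@measurable_le _ (g_sigma_algebraType (F t)) _ (cst 0) (D t) _ (aD t0)).
Qed.

(* The set where [D] approaches 0 strictly before [sig]: there the left limit of
   [D] at [sig] vanishes, although [D] itself might a priori jump away. *)
Let A := B `&` [set w | forall n, sign n w < sig w].

Let FA : stopped_sigma_algebra F sig A.
Proof.
rewrite -stopped_measurableE//.
have -> : A = B `&` \bigcap_n [set w | sign n w < sig w].
  by apply/seteqP; split => w [Bw H]; split => // n; [move=> _; exact: H|exact: H].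
have mS (tau : Omega -> R) : finite_stopping_time F tau ->
    (forall w, tau w <= sig w) ->
    measurable_fun setT
      (tau : g_sigma_algebraType (stopped_sigma_algebra F sig) -> R).
  move=> stau ts _ U mU; rewrite setTI stopped_measurableE//.
  by apply: (stopped_mono ssig ts); exact: stopped_preimage.
apply: measurableI.
  rewrite stopped_measurableE//; apply: stopped_filt t0 ssig _ FB => w.
  exact: hit_ge.
apply: bigcapT_measurable => n.
by apply: measurable_lt; apply: mS.
Qed.

Let mA : measurable A. Proof. by case: FA. Qed.

Let mD s : 0 <= s -> measurable_fun setT (D s).
Proof. by move=> s0; exact: measurable_fun_filt s0 (aD s0). Qed.

Let T10 : 0 <= T + 1.
Proof. by rewrite addr_ge0// (le_trans t0)// ltW. Qed.

Let mDsig : measurable_fun setT (fun w => D (sig w) w).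
Proof.
apply: (@measurable_at_time _ _ _ D T) => //.
- by move=> s s0 _; exact: mD.
- exact: (stopping_measurable ssig).
- by move=> w; rewrite sigT ssig.1.
Qed.

(** Just before [sig], on [A], the process is below any given [e] in absolute value; optional
    stopping carries this bound over to the integral of [D (T + 1)]. *)
Let integral_approach : (\int[P]_(w in A) (D (T + 1) w)%:E = 0)%E.
Proof.
suff eps e : 0 < e -> (`|\int[P]_(w in A) (D (T + 1) w)%:E| <= e%:E)%E.
  apply/eqP; rewrite -abse_eq0 eq_le abse_ge0 andbT; apply/lee_addgt0Pr => e e0.
  by rewrite add0e; exact: eps.
move=> e0.
(* [A] is known only at [sig], so stopping at [sign n] is applied to events of that earlier time
   whose indicators converge to that of [A]. The condition that [D] is nonzero removes the points
   where [sign n] has settled at [sig < T]: there [hit_lt0] would put [sign n] strictly before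
   [sig]. *)
pose C n := B `&` [set w | sign n w < T] `&`
  [set w | D (sign n w) w != 0 /\ `|D (sign n w) w| <= e].
have FC n : stopped_sigma_algebra F (sign n) (C n).
  apply: stopped_setI; first apply: stopped_setI.
  - by apply: stopped_filt t0 _ _ FB => // w; exact: hit_ge.
  - have := stopped_preimage (ssign n) (measurable_itv `]-oo, T[).
    by rewrite set_itvNyo.
  - apply: (@stopped_process _ _ _ _ D _ T [set x | x != 0 /\ `|x| <= e]) => //.
    rewrite (_ : mkset _ = ~` [set 0] `&` `[(- e), e]%classic).
      by apply: measurableI => //; exact: measurableC.
    apply/seteqP; split => x /=; rewrite in_itv/= ler_norml.
      by move=> [/eqP].
    by move=> [/eqP].
have mC n : measurable (C n) by have [] := FC n.
have cv : (\int[P]_(w in C n) (D (T + 1) w)%:E @[n --> \oo] -->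
    \int[P]_(w in A) (D (T + 1) w)%:E)%E.
  apply: (@cvg_integral_sets _ _ _ _ _ _ (fun w => `|D (T + 1) w|)) => //.
  - by move=> _; exact: mD.
  - exact: mD.
  - by have := integrable_abse (iD T10).
  - move=> w [Bw /= Aw].
    have /cvg_norm := hit_cvg0 t0 tT (@rDw w) (@lD w) Aw.
    rewrite normr0 => /cvgr_le /(_ _ e0); apply: filterS => n De.
    have sT : sign n w < T by apply: lt_le_trans (sigT w).
    split => //; split => //; apply/eqP => D0.
    have := hit_eq0 t0 tT (@rDw w) (hit_ge _ tT _) sT D0.
    by rewrite leNgt Aw.
  - move=> w nAw; have [Bw|nBw] := pselect (B w); last first.
      by apply: nearW => n [[]].
    have [n0 n0P] : exists n0, sig w <= sign n0 w.
      apply: contrapT => nex; apply: nAw; split => // n; rewrite ltNge.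
      by apply/negP => sn; apply: nex; exists n.
    exists n0 => // n /= n0n [[_ /= sT] [/= D0 _]].
    have sE : sign n w = sig w.
      apply/eqP; rewrite eq_le sign_sig (le_trans n0P)//.
      by apply: (hit_anti t0 tT (@rDw w)); rewrite lef_pV2 ?posrE ?ltr0n// ler_nat.
    have := hit_lt0 t0 tT (@rDw w) n; rewrite -/(sig w) -/(sign n w) -sE.
    by move=> /(_ sT D0); rewrite ltxx.
  - by move=> w _; exact: cvg_cst.
have bd n : (`|\int[P]_(w in C n) (D (T + 1) w)%:E| <= e%:E)%E.
  rewrite -(optional_stopping aD rD iD ED (ssign n) (signT n) (FC n) (c := e));
    last first.
    by move=> w [_ []].
  have mDn : measurable_fun setT (fun w => D (sign n w) w).
    apply: (@measurable_at_time _ _ _ D T) => //.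
    - by move=> s s0 _; exact: mD.
    - exact: (stopping_measurable (ssign n)).
    - by move=> w; rewrite signT (ssign n).1.
  apply: le_trans (le_abse_integral _ _ _) _ => //.
    by apply/measurable_EFinP; exact: measurable_funTS.
  apply: (@le_trans _ _ (\int[P]_(w in C n) (cst e%:E) w)%E).
    apply: ge0_le_integral => //.
    - apply: measurableT_comp => //.
      by apply/measurable_EFinP; exact: measurable_funTS.
    - by move=> w [_ [_ /=]]; rewrite lee_fin.
  rewrite integral_cst// -[leRHS]mule1.
  by apply: lee_wpmul2l; [rewrite lee_fin ltW|exact: probability_le1].
have cva : (`|\int[P]_(w in C n) (D (T + 1) w)%:E| @[n --> \oo] -->
    `|\int[P]_(w in A) (D (T + 1) w)%:E|)%E by exact: cvg_abse.
rewrite -(cvg_lim _ cva)//.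
apply: lime_le; last by apply: nearW => n; exact: bd.
by apply/cvg_ex; eexists; exact: cva.
Qed.

(** On [A], [nocross] makes the stopped value nonnegative, and its integral is controlled by that of
    [D (T + 1)], which vanishes by the approach from the left. Off [A], a nonzero value at [sig] is
    excluded by [hit_lt0]. *)
Lemma hit_meets : {ae P, forall w, 0 <= D t w -> sig w < T -> D (sig w) w = 0}.
Proof.
(* Truncation supplies the bound that [optional_stopping] asks for at [sig]. *)
pose A_ n := A `&` [set w | `|D (sig w) w| <= n%:R].
have FA_ n : stopped_sigma_algebra F sig (A_ n).
  apply: stopped_setI => //.
  apply: (@stopped_process _ _ _ _ D _ T [set x | `|x| <= n%:R]) => //.
  rewrite (_ : mkset _ = `[(- n%:R), n%:R]%classic)//.
  by apply/seteqP; split => x /=; rewrite in_itv/= ler_norml.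
have mA_ n : measurable (A_ n) by have [] := FA_ n.
have EA_ n : (\int[P]_(w in A_ n) `|(D (sig w) w)%:E| =
             \int[P]_(w in A_ n) (D (T + 1) w)%:E)%E.
  rewrite -(optional_stopping aD rD iD ED ssig sigT (FA_ n) (c := n%:R));
    last first.
    by move=> w [].
  apply: ae_eq_integral => //.
  - apply: measurableT_comp => //.
    by apply/measurable_EFinP; exact: measurable_funTS.
  - by apply/measurable_EFinP; exact: measurable_funTS.
  - by apply: filterS nocross => w Dw [[Bw _] _]; rewrite gee0_abs// lee_fin Dw.
have cv : (\int[P]_(w in A_ n) (D (T + 1) w)%:E @[n --> \oo] --> 0)%E.
  rewrite -integral_approach.
  apply: (@cvg_integral_sets _ _ _ _ _ _ (fun w => `|D (T + 1) w|)) => //.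
  - by move=> _; exact: mD.
  - exact: mD.
  - by have := integrable_abse (iD T10).
  - move=> w Aw; exists (Num.truncn `|D (sig w) w|).+1 => // n /= nn.
    by split => //=; rewrite (le_trans (ltW (truncnS_gt _)))// ler_nat.
  - by move=> w nAw; apply: nearW => n [].
  - by move=> w _; exact: cvg_cst.
(* These integrals are nondecreasing in [n] and tend to 0. *)
have EA0 n : (\int[P]_(w in A_ n) `|(D (sig w) w)%:E| = 0)%E.
  apply/eqP; rewrite eq_le integral_ge0// andbT -(cvg_lim _ cv)//.
  apply: lime_ge; first by apply/cvg_ex; eexists; exact: cv.
  exists n => // m /= nm; rewrite -EA_; apply: ge0_subset_integral => //.
    by apply/measurable_EFinP; apply: measurable_funTS; exact: measurableT_comp.
  by move=> w [Aw /= wn]; split => //=; rewrite (le_trans wn)// ler_nat.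
have ae0 n : {ae P, forall w, A_ n w -> (D (sig w) w)%:E = 0}.
  apply/ae_eq_integral_abs => //.
  by apply/measurable_EFinP; exact: measurable_funTS.
apply: filterS (ae_foralln ae0) => w H Dt sT.
have [Aw|nAw] := pselect (A w).
  have /H[//] : A_ (Num.truncn `|D (sig w) w|).+1 w.
  by split => //=; rewrite ltW// truncnS_gt.
apply/eqP; apply: contrapT => /negP D0; apply: nAw; split => // n.
exact: (hit_lt0 t0 tT (@rDw w) n sT D0).
Qed.

End meeting.

(** * The product space *)

(* The flag [b] selects a coordinate, so that [Y] ([b = true]) and [Z] ([b = false])
   are treated together; [pair_side b x y] has [x] at coordinate [b]. *)
Definition side (U : Type) (b : bool) (w : U * U) : U := if b then w.1 else w.2.

Definition pair_side (U : Type) (b : bool) (x y : U) : U * U :=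
  if b then (x, y) else (y, x).

Lemma pair_sideK (U : Type) b (x y : U) : side b (pair_side b x y) = x.
Proof. by case: b. Qed.

Lemma pair_sideKN (U : Type) b (x y : U) : side (~~ b) (pair_side b x y) = y.
Proof. by case: b. Qed.

Section product_space.
Context d (U : measurableType d) (R : realType) (P : probability U R).

Lemma measurable_side b : measurable_fun setT (side b : U * U -> U).
Proof. by case: b; [exact: measurable_fst|exact: measurable_snd]. Qed.

Lemma measurable_pair_side b y : measurable_fun setT (fun x : U => pair_side b x y).
Proof. by case: b; exact: measurable_fun_pair. Qed.

Lemma measurable_section b y (C : set (U * U)) : measurable C ->
  measurable [set x | C (pair_side b x y)].
Proof.
by move=> mC; have := measurable_pair_side b y measurableT mC; rewrite setTI.
Qed.

Lemma restrict_pair_side b y (C : set (U * U)) (f : U * U -> \bar R) x :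
  (f \_ C) (pair_side b x y) =
  ((fun x => f (pair_side b x y)) \_ [set x | C (pair_side b x y)]) x.
Proof.
by rewrite !patchE; congr (if _ then _ else _); apply/idP/idP; rewrite !inE.
Qed.

Lemma ge0_integral_pair_side b (f : U * U -> \bar R) (C : set (U * U)) :
  measurable C -> measurable_fun setT f -> (forall w, 0 <= f w)%E ->
  (\int[P \x P]_(w in C) f w =
   \int[P]_y \int[P]_(x in [set x | C (pair_side b x y)]) f (pair_side b x y))%E.
Proof.
move=> mC mf f0; rewrite integral_mkcond.
have mfC : measurable_fun setT (f \_ C).
  by apply/(measurable_restrictT _ mC); exact: measurable_funTS.
have fC0 w : (0 <= (f \_ C) w)%E by rewrite patchE; case: ifP.
under [RHS]eq_integral do rewrite integral_mkcond.
transitivity (\int[P]_y \int[P]_x (f \_ C) (pair_side b x y))%E.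
  by case: b; [exact: fubini_tonelli2|exact: fubini_tonelli1].
by apply: eq_integral => y _; apply: eq_integral => x _; exact: restrict_pair_side.
Qed.

Lemma integral_pair_side b (f : U * U -> \bar R) (C : set (U * U)) :
  measurable C -> (P \x P)%E.-integrable setT f ->
  (\int[P \x P]_(w in C) f w =
   \int[P]_y \int[P]_(x in [set x | C (pair_side b x y)]) f (pair_side b x y))%E.
Proof.
move=> mC intf; rewrite integral_mkcond.
have ifC : (P \x P)%E.-integrable setT (f \_ C).
  by apply/(integrable_mkcond _ mC); exact: (integrableS measurableT).
under [RHS]eq_integral do rewrite integral_mkcond.
transitivity (\int[P]_y \int[P]_x (f \_ C) (pair_side b x y))%E.
  by case: b; rewrite ?integral21_prod_meas1 ?integral12_prod_meas1.
by apply: eq_integral => y _; apply: eq_integral => x _; exact: restrict_pair_side.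
Qed.

Lemma integrable_side b (f : U -> R) : P.-integrable setT (EFin \o f) ->
  (P \x P)%E.-integrable setT (EFin \o (f \o side b)).
Proof.
move=> /integrableP[mf intf].
have mf' : measurable_fun setT f by apply/measurable_EFinP.
have mfb : measurable_fun setT (EFin \o (f \o side b)).
  by apply/measurable_EFinP; apply: measurableT_comp => //; exact: measurable_side.
apply/integrableP; split=> //.
rewrite (@ge0_integral_pair_side b)//; last by apply: measurableT_comp.
under eq_integral do under eq_integral do rewrite /= pair_sideK.
rewrite [ltLHS](_ : _ = \int[P]_y (cst (\int[P]_x `|(f x)%:E|) y))%E//.
rewrite integral_cst// [X in (_ * X)%E](_ : _ = 1%E) ?mule1//.
exact: probability_setT.
Qed.

Variable F : filtration U R.

(** It contains the product of [F t] with itself. Defining it by sections makes sections of stopping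
    times and of stopped events fall into [F] at once, while Fubini's theorem still transfers the
    martingale property. *)
Definition prod_filt t : set_system (U * U) :=
  [set C | measurable C /\ forall b y, F t [set x | C (pair_side b x y)]].

Lemma prod_filt_sigma t : 0 <= t -> sigma_algebra setT (prod_filt t).
Proof.
move=> t0; split.
- by split => // b y; rewrite -filt_measurableE//; exact: measurable0.
- move=> C [mC FC]; split; first exact: measurableD.
  by move=> b y; apply: (filt_setD t0 (filt_setT F t0) (FC b y)).
- move=> C FC; split; first by apply: bigcupT_measurable => n; have [] := FC n.
  move=> b y; rewrite (_ : mkset _ = \bigcup_k [set x | C k (pair_side b x y)]).
    rewrite -filt_measurableE//; apply: bigcupT_measurable => n.
    by apply: filt_measurable => //; exact: (FC n).2.
  by apply/seteqP; split => x [n _ Cn]; exists n.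
Qed.

Lemma prod_filt_sub t : 0 <= t -> prod_filt t `<=` measurable.
Proof. by move=> _ C []. Qed.

Lemma prod_filt_mono s t : 0 <= s -> s <= t -> prod_filt s `<=` prod_filt t.
Proof. by move=> s0 st C [mC FC]; split=> // b y; exact: (filt_mono s0 st). Qed.

Definition prod_filtration : filtration (U * U)%type R :=
  Filtration prod_filt_sigma prod_filt_sub prod_filt_mono.

Lemma section_stopping tau b y : finite_stopping_time prod_filtration tau ->
  finite_stopping_time F (fun x => tau (pair_side b x y)).
Proof. by move=> [tau0 Ftau]; split=> // t t0; have [_] := Ftau t t0; apply. Qed.

Lemma section_stopped tau b y C : stopped_sigma_algebra prod_filtration tau C ->
  stopped_sigma_algebra F (fun x => tau (pair_side b x y))
    [set x | C (pair_side b x y)].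
Proof.
move=> [mC FC]; split; first exact: measurable_section.
by move=> t t0; have [_] := FC t t0; apply.
Qed.

Lemma prod_filt_adapted (V : U * U -> R) t : 0 <= t ->
  measurable_fun setT V ->
  (forall b y, measurable_fun setT
     ((fun x => V (pair_side b x y)) : g_sigma_algebraType (F t) -> R)) ->
  measurable_fun setT (V : g_sigma_algebraType (prod_filtration t) -> R).
Proof.
move=> t0 mV mVs _ B mB; rewrite filt_measurableE// setTI; split.
  by rewrite -[X in measurable X]setTI; exact: mV.
move=> b y; have := mVs b y measurableT B mB.
by rewrite filt_measurableE// setTI.
Qed.

Lemma side_adapted (V : U -> R) t b : 0 <= t ->
  measurable_fun setT (V : g_sigma_algebraType (F t) -> R) ->
  measurable_fun setT
    ((V \o side b) : g_sigma_algebraType (prod_filtration t) -> R).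
Proof.
move=> t0 mV; have mV' := measurable_fun_filt t0 mV.
apply: prod_filt_adapted => //.
  by apply: measurableT_comp => //; exact: measurable_side.
move=> b' y; have [->|bb'] := eqVneq b' b.
  by under eq_fun do rewrite /= pair_sideK; exact: mV.
have -> : b = ~~ b' by case: b b' bb' => -[].
by under eq_fun do rewrite /= pair_sideKN; exact: measurable_cst.
Qed.

End product_space.

Lemma condexp_ge0 d (Omega : measurableType d) (R : realType)
    (P : probability Omega R) (G : set_system Omega) (U V : Omega -> R) :
  sigma_algebra setT G -> G `<=` measurable ->
  is_condexp P G U V -> (forall w, 0 <= U w) -> {ae P, forall w, 0 <= V w}.
Proof.
move=> sG Gm [iU iV mV EV] U0.
pose C := [set w | V w < 0].
have GC : G C.
  rewrite -(sigma_algebra_id sG).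
  exact: (@measurable_lt _ (g_sigma_algebraType G) R V (cst 0)).
have mC : measurable C by exact: Gm.
have iVC := integrableS measurableT mC (@subsetT _ _) iV.
have := integral_ge0_lt0_ae mC iVC (fun w Cw => Cw).
rewrite EV// integral_ge0 => [|w _]; last by rewrite lee_fin.
by move=> /(_ isT); apply: filterS => w; rewrite leNgt => /negP.
Qed.

Section process.
Context d (Omega : measurableType d) (R : realType).
Variables (P : probability Omega R) (F : filtration Omega R).
Variable X : R -> {RV P >-> R}.

Lemma martingale_integral s t A : martingale F X -> 0 <= s -> s <= t -> F s A ->
  (\int[P]_(w in A) (X s w)%:E = \int[P]_(w in A) (X t w)%:E)%E.
Proof.
move=> [_ _ martX] s0 st FA; have [V [_ iV _ EV] XV] := martX s t s0 st.
have mA : measurable A := filt_sub s0 FA.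
rewrite -EV//; apply: ae_eq_integral => //.
- by apply: measurable_funTS; apply/measurable_EFinP.
- by apply: measurable_funTS; exact: measurable_int iV.
- by apply: filterS XV => w ->.
Qed.

(** The function from [strong_markov] is replaced by its positive part, extended by 0 to negative
    times, so that Tonelli's theorem applies to it on the product space. Since [h] is nonnegative,
    this changes its values along [(tau, X tau)] only on a null set. *)
Lemma strong_markov_integral (h : R -> R) (r : R) :
  adapted F X -> right_continuous_paths X -> strong_markov F X ->
  measurable_fun setT h -> (forall x, 0 <= h x <= 1) -> 0 <= r ->
  exists phi : R * R -> R,
    [/\ measurable_fun setT phi, forall u, 0 <= phi u &
        forall tau v A, finite_stopping_time F tau -> (forall w, tau w <= v) ->
          stopped_sigma_algebra F tau A ->
          (\int[P]_(w in A) (h (X (tau w + r) w))%:E =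
           \int[P]_(w in A) (phi (tau w, X (tau w) w))%:E)%E].
Proof.
move=> aX rX markX mh h01 r0.
have bh : bounded_fun h.
  exists 1; split => // x x1 y _ /=; have /andP[h0 h1] := h01 y.
  by rewrite ger0_norm// (le_trans h1)// ltW.
have [f mf fP] := markX h mh bh r r0.
pose E := [set u : R | 0 <= u] `*` [set: R].
have mE : measurable E.
  by apply: measurableX => //; exact: (@measurable_le _ R R (cst 0) id).
pose phi := (fun u => Num.max 0 (f u)) \_ E.
have mphi : measurable_fun setT phi.
  apply/(measurable_restrictT _ mE); apply: measurable_maxr => //.
exists phi; split => //.
  by move=> u; rewrite /phi patchE; case: ifP => // _; rewrite le_max lexx.
move=> tau v A stau tauv FA.
have [V cV fV] := fP tau stau; have [_ iV mV EV] := cV.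
have mA : measurable A by case: FA.
rewrite -EV//.
have Vge0 := condexp_ge0 (sigma_algebra_stopped stau) _ cV.
have V0 : {ae P, forall w, 0 <= V w}.
  by apply: Vge0 => [B []//|w]; case/andP: (h01 (X (tau w + r) w)).
apply: ae_eq_integral => //.
- by apply: measurable_funTS; exact: measurable_int iV.
- apply: measurable_funTS; apply/measurable_EFinP.
  apply: (measurableT_comp mphi); apply: measurable_fun_pair.
    exact: stopping_measurable stau.
  apply: (@measurable_at_time _ _ _ X v) => //.
    exact: stopping_measurable stau.
  by move=> w; rewrite stau.1 tauv.
- apply: filterS2 V0 fV => w V0 fV _; congr (_%:E).
  by rewrite /phi patchE mem_set ?fV ?max_r//; split => //=; exact: stau.1.
Qed.

End process.

Section copies.
Context d (Omega : measurableType d) (R : realType).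
Variables (P : probability Omega R) (X : R -> {RV P >-> R}).

Lemma measurable_coord_process b t :
  measurable_fun setT (fun w : Omega * Omega => X t (side b w)).
Proof. by apply: measurableT_comp => //; exact: measurable_side. Qed.

Definition copy b t : {RV (P \x P)%E >-> R} :=
  mfun_Sub (mem_set (measurable_coord_process b t)).

Lemma measurable_path_event A : path_sigma_algebra A -> measurable (path_event X A).
Proof.
pose G := [set A : set (R -> R) | measurable (path_event X A)].
suff : path_sigma_algebra (R:=R) `<=` G by apply.
apply: smallest_sub.
  split => [|B mB|B mB]; rewrite /G/=.
  - exact: measurable0.
  - rewrite (_ : path_event _ _ = ~` path_event X B); first exact: measurableC.
    by apply/seteqP; split => w; rewrite /path_event/=; [case|].
  - rewrite (_ : path_event _ _ = \bigcup_k path_event X (B k)).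
      exact: bigcupT_measurable.
    by apply/seteqP; split => w [n _ Bn]; exists n.
move=> _ [s [B [s0 mB ->]]]; rewrite /G /path_event /=.
by rewrite -[X in measurable X]setTI; exact: (measurable_funP (X s)).
Qed.

Lemma path_event_copyT A :
  path_event (copy true) A = path_event X A `*` setT.
Proof. by apply/seteqP; split => [w Aw|w []]. Qed.

Lemma path_event_copyF A :
  path_event (copy false) A = setT `*` path_event X A.
Proof. by apply/seteqP; split => [w Aw|w []]. Qed.

Lemma copy_same_distribution b : same_distribution (copy b) X.
Proof.
move=> A pA; have mA := measurable_path_event pA.
case: b; rewrite ?path_event_copyT ?path_event_copyF.
- apply: (etrans (product_measure1E P P mA measurableT)).
  by rewrite [X in (_ * X)%E](_ : _ = 1%E) ?mule1//; exact: probability_setT.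
- apply: (etrans (product_measure1E P P measurableT mA)).
  by rewrite [X in (X * _)%E](_ : _ = 1%E) ?mul1e//; exact: probability_setT.
Qed.

Lemma copies_independent : independent_processes (copy true) (copy false).
Proof.
move=> A B pA pB; have mA := measurable_path_event pA.
have mB := measurable_path_event pB.
rewrite !copy_same_distribution// path_event_copyT path_event_copyF.
by rewrite -setXI setIT setTI; exact: product_measure1E.
Qed.

Lemma copies_no_crossing s t : almost_continuous X -> 0 <= s -> s < t ->
  {ae (P \x P)%E, forall w, ~ [/\ X s w.1 < X s w.2, X t w.2 < X t w.1 &
      forall u, s < u -> u < t -> X u w.1 != X u w.2]}.
Proof.
move=> [cX _ ncX] s0 st.
have cadc b : cadlag (copy b).
  move=> w; have [cr cl] := cX (side b w); split => u u0.
    exact: cr.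
  exact: cl.
have := ncX _ _ _ (copy true) (copy false) (cadc _) (cadc _)
  (copy_same_distribution _) (copy_same_distribution _) copies_independent
  s t s0 st.
by apply: negligibleS => w /= /contrapT.
Qed.

End copies.

(** * Coupling two independent copies *)

Section gap.
Context d (Omega : measurableType d) (R : realType).
Variables (P : probability Omega R) (F : filtration Omega R).
Variable X : R -> {RV P >-> R}.
Hypothesis martX : martingale F X.
Hypothesis acX : almost_continuous X.
Variables (t T : R).
Hypotheses (t0 : 0 <= t) (tT : t < T).

Let PP := (P \x P)%E.
Let FF := prod_filtration F.

Let aX : adapted F X. Proof. by case: martX. Qed.

Let iX s : 0 <= s -> P.-integrable setT (EFin \o X s).
Proof. by case: martX => _ + _; exact. Qed.

Let rX : right_continuous_paths X.
Proof. by case: acX => cX _ _ w s s0; exact: (cX w).1. Qed.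

Definition gap s (w : Omega * Omega) : R := X s (side false w) - X s (side true w).

Let adapted_side b : adapted_to FF (fun s w => X s (side b w)).
Proof. by move=> s s0; exact: side_adapted s0 (aX s0). Qed.

Lemma gap_adapted : adapted_to FF gap.
Proof.
move=> s s0; apply: (@measurable_funB _ (g_sigma_algebraType (FF s)));
  exact: adapted_side.
Qed.

Lemma gap_right_continuous : right_continuous_paths gap.
Proof. by move=> w s s0; apply: cvgB; exact: rX. Qed.

Lemma gap_left_limits w s : 0 < s -> cvg (gap x w @[x --> s^'-]).
Proof.
move=> s0; case: acX => cX _ _; rewrite /gap.
by apply: is_cvgB; exact: (cX _).2.
Qed.

Lemma gap_integrable s : 0 <= s -> PP.-integrable setT (EFin \o gap s).
Proof.
move=> s0; rewrite (_ : _ \o _ =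
  (EFin \o (X s \o side false)) \- (EFin \o (X s \o side true)))%E//.
by apply: integrableB => //; exact: integrable_side (iX s0).
Qed.

(** With the other coordinate frozen, each coordinate is integrated over a section of [A], which is
    in [F s]; Fubini's theorem reassembles the sections. *)
Lemma gap_martingale s u A : 0 <= s -> s <= u -> FF s A ->
  (\int[PP]_(w in A) (gap s w)%:E = \int[PP]_(w in A) (gap u w)%:E)%E.
Proof.
move=> s0 su FA; have u0 : 0 <= u by exact: le_trans su.
have mA : measurable A by case: FA.
have E b : (\int[PP]_(w in A) (X s (side b w))%:E =
            \int[PP]_(w in A) (X u (side b w))%:E)%E.
  rewrite !(integral_pair_side b)//;
    [|exact: integrable_side (iX u0)|exact: integrable_side (iX s0)].
  apply: eq_integral => y _.
  under eq_integral do rewrite pair_sideK.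
  under [RHS]eq_integral do rewrite pair_sideK.
  by apply: martingale_integral martX s0 su _; exact: FA.2.
have i b v : 0 <= v -> PP.-integrable A (EFin \o (X v \o side b)).
  move=> v0; apply: (integrableS measurableT mA (@subsetT _ _)).
  exact: integrable_side (iX v0).
rewrite /gap; under eq_integral do rewrite EFinB.
under [RHS]eq_integral do rewrite EFinB.
by rewrite !integralB_EFin ?E//; exact: i.
Qed.

Definition meeting_time w := hit (gap ^~ w) t T 0.

Lemma meet_stopping : finite_stopping_time FF meeting_time.
Proof. exact: hit_stopping t0 tT gap_adapted gap_right_continuous _. Qed.

(** A negative gap at the meeting time would persist, by right continuity, up to a rational time
    just after it. Between [t] and that time the gap is nonzero, first because the paths have not
    met and then because it is negative: this is a crossing between deterministic times. Countably
    many of these events remain null. *)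
Lemma gap_meet_ge0 : {ae PP, forall w, 0 <= gap t w -> 0 <= gap (meeting_time w) w}.
Proof.
have nc (q : rat) : {ae PP, forall w, t < ratr q ->
    ~ [/\ X t w.1 < X t w.2, X (ratr q) w.2 < X (ratr q) w.1 &
      forall u, t < u -> u < ratr q -> X u w.1 != X u w.2]}.
  have [tq|qt] := ltP t (ratr q); last by exact: aeW.
  by apply: filterS (copies_no_crossing acX t0 tq) => w.
have nc' : {ae PP, forall w, forall n, if unpickle n is Some q then
   t < ratr q -> ~ [/\ X t w.1 < X t w.2, X (ratr q) w.2 < X (ratr q) w.1 &
      forall u, t < u -> u < ratr q -> X u w.1 != X u w.2] else True}.
  apply: ae_foralln => n; case: (unpickle n) => [q|]; last exact: aeW.
  exact: nc.
apply: filterS nc' => w H gt0; rewrite leNgt; apply/negP => gm.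
have rg := gap_right_continuous (w := w).
have tm : t <= meeting_time w by exact: hit_ge.
have m0 : 0 <= meeting_time w by exact: le_trans tm.
have gtp : 0 < gap t w.
  rewrite lt_neqAle gt0 andbT; apply/eqP => g0.
  have := hit_eq0 t0 tT rg (lexx t) tT (esym g0); rewrite -/(meeting_time w) => mt.
  by move: gm; rewrite (@le_anti _ _ (meeting_time w) t) ?tm ?mt// -g0 ltxx.
have /cvgr_lt /(_ _ gm) /near_rightE[e e0 He] := rg _ m0.
have [q] : exists q, ratr q \in `]meeting_time w, meeting_time w + e[.
  by apply: rat_in_itvoo; rewrite ltrDl.
rewrite in_itv/= => /andP[mq qe].
have := H (pickle q); rewrite pickleK => /(_ (le_lt_trans tm mq)); apply; split.
- by rewrite -subr_gt0.
- by rewrite -subr_lt0; apply: He; rewrite mq.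
- move=> u tu uq; have [um|mu] := ltP u (meeting_time w).
    apply/eqP => ue; have : gap u w = 0 by rewrite /gap /= ue subrr.
    have uT : u < T by apply: lt_le_trans um _; exact: hit_le.
    move=> /(hit_eq0 t0 tT rg (ltW tu) uT); rewrite -/(meeting_time w).
    by rewrite leNgt um.
  have : gap u w < 0.
    move: mu; rewrite le_eqVlt => /predU1P[<-//|mu].
    by apply: He; rewrite mu (lt_trans uq).
  by rewrite subr_lt0 => /gt_eqF ->.
Qed.

Lemma gap_meet_eq0 : {ae PP, forall w,
  0 <= gap t w -> meeting_time w < T -> gap (meeting_time w) w = 0}.
Proof.
apply: (@hit_meets _ _ _ PP FF gap t T) => //.
- exact: gap_adapted.
- exact: gap_right_continuous.
- exact: gap_left_limits.
- exact: gap_integrable.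
- exact: gap_martingale.
- exact: gap_meet_ge0.
Qed.

End gap.

(** * Equality of laws after the meeting time *)

Section law_after_meeting.
Context d (Omega : measurableType d) (R : realType).
Variables (P : probability Omega R) (F : filtration Omega R).
Variable X : R -> {RV P >-> R}.
Hypotheses (martX : martingale F X) (markX : strong_markov F X).
Hypothesis acX : almost_continuous X.
Variables (t T : R).
Hypotheses (t0 : 0 <= t) (tT : t < T).

Let PP := (P \x P)%E.
Let FF := prod_filtration F.

Let aX : adapted F X. Proof. by case: martX. Qed.

Let rX : right_continuous_paths X.
Proof. by case: acX => cX _ _ w s s0; exact: (cX w).1. Qed.

Let rside b : right_continuous_paths (fun s w => X s (side b w)).
Proof. by move=> w s s0; exact: rX. Qed.

Let mside b s : measurable_fun setT (fun w => X s (side b w)).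
Proof. by apply: measurableT_comp => //; exact: measurable_side. Qed.

Let T0 : 0 <= T. Proof. by rewrite (le_trans t0)// ltW. Qed.

Lemma measurable_side_at b v (rho : Omega * Omega -> R) :
  measurable_fun setT rho -> (forall w, 0 <= rho w <= v) ->
  measurable_fun setT (fun w => X (rho w) (side b w)).
Proof.
move=> mrho rho0v.
by apply: (@measurable_at_time _ _ _ (fun s w => X s (side b w)) v).
Qed.

(** One [phi] serves both values of [b]: this is what makes the two copies comparable once they are
    at the same place at the same time. *)
Lemma strong_markov_side (h : R -> R) (r : R) :
  measurable_fun setT h -> (forall x, 0 <= h x <= 1) -> 0 <= r ->
  exists phi : R * R -> R,
    [/\ measurable_fun setT phi, forall u, 0 <= phi u &
        forall b tau v A, finite_stopping_time FF tau -> (forall w, tau w <= v) ->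
          stopped_sigma_algebra FF tau A ->
          (\int[PP]_(w in A) (h (X (tau w + r) (side b w)))%:E =
           \int[PP]_(w in A) (phi (tau w, X (tau w) (side b w)))%:E)%E].
Proof.
move=> mh h01 r0.
have [phi [mphi phi0 phiP]] := strong_markov_integral aX rX markX mh h01 r0.
exists phi; split => // b tau v A stau tauv FA.
have mA : measurable A by case: FA.
have mtau := stopping_measurable stau.
have mh' : measurable_fun setT (fun w => (h (X (tau w + r) (side b w)))%:E).
  apply/measurable_EFinP; apply: (measurableT_comp mh).
  apply: (@measurable_side_at b (v + r) (fun w => tau w + r)).
    exact: measurable_funD.
  by move=> w; rewrite lerD2r tauv addr_ge0// stau.1.
have mphi' : measurable_fun setT (fun w => (phi (tau w, X (tau w) (side b w)))%:E).
  apply/measurable_EFinP; apply: (measurableT_comp mphi).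
  apply: measurable_fun_pair => //.
  by apply: (@measurable_side_at b v tau) => // w; rewrite tauv stau.1.
have h0 w : (0 <= (h (X (tau w + r) (side b w)))%:E)%E.
  by rewrite lee_fin; case/andP: (h01 (X (tau w + r) (side b w))).
rewrite !(ge0_integral_pair_side P b)//; last by move=> w; rewrite lee_fin.
apply: eq_integral => y _.
under eq_integral do rewrite pair_sideK.
under [RHS]eq_integral do rewrite pair_sideK.
apply: (phiP (fun x => tau (pair_side b x y)) v) => //.
- exact: section_stopping.
- exact: section_stopped.
Qed.

Let tau := meeting_time X t T.

Let meetT w : tau w <= T. Proof. exact: hit_le. Qed.

Let smeet : finite_stopping_time FF (tau).
Proof. exact: meet_stopping. Qed.

Let mmeet : measurable_fun setT (tau).
Proof. exact: stopping_measurable smeet. Qed.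

Section after_meeting.
Variable S : set (Omega * Omega).
Hypotheses (FS : FF t S) (S_ge0 : forall w, S w -> 0 <= gap X t w).

Definition met := S `&` [set w | tau w < T].

Lemma stopped_met : stopped_sigma_algebra FF (tau) met.
Proof.
apply: stopped_setI.
  by apply: stopped_filt t0 smeet _ FS => w; exact: hit_ge.
have := stopped_preimage smeet (measurable_itv `]-oo, T[).
by rewrite set_itvNyo.
Qed.

Lemma measurable_met : measurable met. Proof. by case: stopped_met. Qed.

(** The lag [T - tau] is random. Rounded up to a multiple of 1/(m+1) it is constant on each fiber,
    where [phi] takes equal values for the two copies almost everywhere. As [m] grows, the rounded
    end time tends to [T] from the right, and right continuity of the paths with continuity of [h]
    gives the limit. *)
Lemma met_same_law (h : R -> R) : continuous h -> (forall x, 0 <= h x <= 1) ->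
  (\int[PP]_(w in met) (h (X T (side true w)))%:E =
   \int[PP]_(w in met) (h (X T (side false w)))%:E)%E.
Proof.
move=> ch h01; have mh : measurable_fun setT h by exact: continuous_measurable_fun.
have mmet := measurable_met.
have Tm0 w : 0 <= T - tau w by rewrite subr_ge0.
pose rho m w := tau w + grid m (T - tau w).
have rhoT m w : T < rho m w by rewrite /rho -ltrBlDl lt_grid.
have rho_le m w : rho m w <= T + 1.
  rewrite /rho -lerBrDl; apply: le_trans (grid_le _ (Tm0 w)) _.
  by rewrite [leRHS]addrAC lerD2l// invf_le1// ler1n.
(* The fiber must be an event of the stopped sigma-algebra, hence the preimage under [tau] of a
   Borel set of times; the maximum with 0 only matters for times beyond [T]. *)
have mcell m j : measurable [set x : R | cell m (Num.max 0 (T - x)) = j].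
  apply: measurable_cell => [|x]; last by rewrite le_max lexx.
  by apply: measurable_maxr => //; apply: measurable_funB.
have cellE m w : cell m (Num.max 0 (T - tau w)) = cell m (T - tau w).
  by rewrite max_r.
have mcellT m j : measurable [set w | cell m (T - tau w) = j].
  apply: measurable_cell => //; exact: measurable_funB.
have mrho m : measurable_fun setT (rho m).
  apply: measurable_funD => //.
  move=> _ B mB; rewrite setTI; rewrite (_ : _ @^-1` _ =
    \bigcup_(j in [set j | B (j.+1%:R / m.+1%:R)])
      [set w | cell m (T - tau w) = j]).
    by apply: bigcup_measurable => j _; exact: mcellT.
  apply/seteqP; split => [w Bw|w [j Bj] /= jE].
    by exists (cell m (T - tau w)).
  by rewrite /grid jE.
have mX b m : measurable_fun setT (fun w => h (X (rho m w) (side b w))).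
  apply: (measurableT_comp mh); apply: (@measurable_side_at b (T + 1)) => // w.
  by rewrite rho_le (le_trans T0)// ltW.
have hle x : `|h x| <= 1 by case/andP: (h01 x) => h0 h1; rewrite ger0_norm.
have Eh m : (\int[PP]_(w in met) (h (X (rho m w) (side true w)))%:E =
             \int[PP]_(w in met) (h (X (rho m w) (side false w)))%:E)%E.
  have ib b : PP.-integrable met (EFin \o (fun w => h (X (rho m w) (side b w)))).
    apply: measurable_bounded_integrable => //.
    - by rewrite (le_lt_trans (probability_le1 _ _))// ltry.
    - exact: measurable_funTS.
    - by exists 1; split => // x x1 w _ /=; rewrite (le_trans (hle _))// ltW.
  apply: (@eq_integral_fibers _ _ _ _ (fun w => cell m (T - tau w))) => // j.
  set A := _ `&` _.
  have FA : stopped_sigma_algebra FF (tau) A.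
    apply: stopped_setI; first exact: stopped_met.
    have := stopped_preimage smeet (mcell m j).
    by rewrite (_ : _ @^-1` _ = [set w | cell m (T - tau w) = j])//;
       apply/seteqP; split => w /=; rewrite cellE.
  have mA : measurable A by case: FA.
  pose r : R := j.+1%:R / m.+1%:R.
  have r0 : 0 <= r by rewrite divr_ge0.
  have [phi [mphi phi0 phiP]] := strong_markov_side mh h01 r0.
  have AE b : (\int[PP]_(w in A) (h (X (rho m w) (side b w)))%:E =
      \int[PP]_(w in A) (phi (tau w, X (tau w) (side b w)))%:E)%E.
    rewrite -(phiP b _ T)//; apply: eq_integral => w; rewrite inE => -[_ /= wj].
    by rewrite /rho /grid wj.
  have mphib b : measurable_fun A
      (fun w => (phi (tau w, X (tau w) (side b w)))%:E).
    apply: measurable_funTS; apply/measurable_EFinP; apply: (measurableT_comp mphi).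
    apply: measurable_fun_pair => //.
    by apply: (@measurable_side_at b T) => // w; rewrite meetT smeet.1.
  rewrite !AE; apply: ae_eq_integral => //.
  apply: filterS (gap_meet_eq0 martX acX t0 tT) => w H [[Sw /= mw] _].
  by have /eqP := H (S_ge0 Sw) mw; rewrite subr_eq0 => /eqP ->.
have cv b : (\int[PP]_(w in met) (h (X (rho m w) (side b w)))%:E @[m --> \oo] -->
    \int[PP]_(w in met) (h (X T (side b w)))%:E)%E.
  apply: (@cvg_integral_sets _ _ _ _ _ _ (cst 1)) => //.
  - by apply: (measurableT_comp mh); exact: mside.
  - exact: (finite_measure_integrable_cst ((P \x P)%E : probability _ R)).
  - by move=> w Sw; exact: nearW.
  - by move=> w Sw; exact: nearW.
  - move=> w _; apply: continuous_cvg; first exact: ch.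
    have /cvg_at_rightP := rX (w := side b w) T0; apply; split => //.
    rewrite /rho -[X in _ --> X](subrKC (tau w)).
    by apply: cvgD; [exact: cvg_cst|exact: cvg_grid].
rewrite -(cvg_lim _ (cv true))// -(cvg_lim _ (cv false))//.
by congr (lim (_ @ \oo)); apply/funext => m; exact: Eh.
Qed.

End after_meeting.

End law_after_meeting.

(** * Monotonicity of the conditional expectation *)

Section monotone_expectation.
Context d (Omega : measurableType d) (R : realType).
Variables (P : probability Omega R) (F : filtration Omega R).
Variable X : R -> {RV P >-> R}.
Hypotheses (martX : martingale F X) (markX : strong_markov F X).
Hypothesis acX : almost_continuous X.
Variables (t T : R).
Hypotheses (t0 : 0 <= t) (tT : t < T).

Let PP : probability (Omega * Omega)%type R := (P \x P)%E.
Let FF := prod_filtration F.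

Let mside b s : measurable_fun setT (fun w => X s (side b w)).
Proof. by apply: measurableT_comp => //; exact: measurable_side. Qed.

Variable u : R -> R.
Hypotheses (cu : continuous u) (iu : P.-integrable setT (EFin \o (u \o X T))).

Let mu : measurable_fun setT u. Proof. exact: continuous_measurable_fun. Qed.

Let iuside b : PP.-integrable setT (EFin \o (fun w => u (X T (side b w)))).
Proof. exact: integrable_side iu. Qed.

Section after_meeting.
Variable S : set (Omega * Omega).
Hypotheses (FS : FF t S) (S_ge0 : forall w, S w -> 0 <= gap X t w).

Let M := met X t T S.

Let mM : measurable M. Proof. exact: (measurable_met martX acX t0 tT). Qed.

(** Truncating [u] at height n+1 and rescaling affinely gives continuous test functions with values
    in [0, 1]; the truncation is removed by domination by [|u (X T)|]. *)
Lemma met_same_integral :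
  (\int[PP]_(w in M) (u (X T (side true w)))%:E =
   \int[PP]_(w in M) (u (X T (side false w)))%:E)%E.
Proof.
pose f (n : nat) x : R := Num.max (- n.+1%:R) (Num.min n.+1%:R (u x)).
have fbd n x : - n.+1%:R <= f n x <= n.+1%:R.
  have : 0 <= n.+1%:R :> R by [].
  by rewrite /f le_max lexx/= ge_max ge_min lexx/= andbT; move: n.+1%:R => N; lra.
have fu n x : `|f n x| <= `|u x|.
  have : 0 <= n.+1%:R :> R by [].
  rewrite /f; move: n.+1%:R => N N0; case: (leP N (u x)) => h1; first last.
    case: (leP (- N) (u x)) => h2 //.
    by rewrite normrN ger0_norm ?ler0_norm//; lra.
  by rewrite max_r ?ger0_norm; lra.
have mf n : measurable_fun setT (f n).
  by apply: measurable_maxr => //; exact: measurable_minr.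
have cf n : continuous (f n).
  move=> x; apply: (@continuous_max R R (cst _) (fun x => Num.min _ (u x))).
    exact: cvg_cst.
  by apply: (@continuous_min R R (cst _) u); [exact: cvg_cst|exact: cu].
have E n : (\int[PP]_(w in M) (f n (X T (side true w)))%:E =
            \int[PP]_(w in M) (f n (X T (side false w)))%:E)%E.
  pose N : R := n.+1%:R; have N0 : 0 < N by rewrite ltr0n.
  pose h x := (f n x + N) / (2 * N).
  have h01 x : 0 <= h x <= 1.
    have /andP[] := fbd n x; rewrite -/N => l r.
    by rewrite /h divr_ge0 ?ler_pdivrMr; lra.
  have ch : continuous h.
    by move=> x; apply: cvgMl; apply: cvgD; [exact: cf|exact: cvg_cst].
  have mh : measurable_fun setT h by exact: continuous_measurable_fun.
  have fh x : f n x = 2 * N * h x - N.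
    by rewrite /h; field; lra.
  have ih b : PP.-integrable M (EFin \o (fun w => h (X T (side b w)))).
    apply: measurable_bounded_integrable => //.
    - by rewrite (le_lt_trans (probability_le1 _ _))// ltry.
    - by apply: measurable_funTS; exact: (measurableT_comp mh).
    - exists 1; split => // x x1 w _ /=; have /andP[h0 h1] := h01 (X T (side b w)).
      by rewrite ger0_norm// (le_trans h1)// ltW.
  have Eb b : (\int[PP]_(w in M) (f n (X T (side b w)))%:E =
      (2 * N)%:E * \int[PP]_(w in M) (h (X T (side b w)))%:E -
      \int[PP]_(w in M) (N)%:E)%E.
    under eq_integral do rewrite fh EFinB EFinM.
    rewrite integralB//; first by rewrite integralZl//; exact: ih.
    - by have := integrableZl mM (2 * N) (ih b).
    - exact: (finite_measure_integrable_cst PP).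
  by rewrite !Eb (met_same_law martX markX acX t0 tT FS S_ge0 ch h01).
have cv b : (\int[PP]_(w in M) (f n (X T (side b w)))%:E @[n --> \oo] -->
    \int[PP]_(w in M) (u (X T (side b w)))%:E)%E.
  apply: (@cvg_integral_sets _ _ _ _ _ _ (fun w => `|u (X T (side b w))|)) => //.
  - by move=> n; exact: (measurableT_comp (mf n)).
  - exact: (measurableT_comp mu).
  - by have := integrable_abse (iuside b).
  - by move=> w Mw; exact: nearW.
  - by move=> w Mw; exact: nearW.
  - move=> w _; apply: cvg_near_cst.
    set x := X T (side b w); exists (Num.truncn `|u x|).+1 => // n /= nn.
    have un : `|u x| <= n.+1%:R.
      by rewrite (le_trans (ltW (truncnS_gt _)))// ler_nat ltnW// ltnS.
    by move: un; rewrite ler_norml /f => /andP[ul ur]; rewrite min_r// max_r.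
rewrite -(cvg_lim _ (cv true))// -(cvg_lim _ (cv false))//.
by congr (lim (_ @ \oo)); apply/funext => n; exact: E.
Qed.

Lemma coupling_integral_ge0 : {homo u : x y / x <= y} ->
  (0 <= \int[PP]_(w in S) (u (X T (side false w)) - u (X T (side true w)))%:E)%E.
Proof.
move=> u_mono.
have mS : measurable S by case: FS.
have SE : S = M `|` (S `\` M).
  by rewrite setDUK// => w [].
have mSM : measurable (S `\` M) by exact: measurableD.
have iM b A : measurable A ->
    PP.-integrable A (EFin \o (fun w => u (X T (side b w)))).
  by move=> mA; exact: (integrableS measurableT mA (@subsetT _ _) (iuside b)).
pose du w := u (X T (side false w)) - u (X T (side true w)).
have mdu : measurable_fun setT du.
  by apply: measurable_funB; exact: (measurableT_comp mu).
have mdiff : measurable_fun setT (EFin \o du) by exact/measurable_EFinP.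
rewrite SE integral_setU//; last 2 first.
- exact: measurable_funTS.
- by rewrite /disj_set setDIK.
rewrite [X in (X + _)%E](_ : _ = 0)%E ?add0e; last first.
  under eq_integral do rewrite EFinB.
  rewrite integralB_EFin//; [|exact: iM|exact: iM].
  rewrite met_same_integral subee// integrable_fin_num//.
  exact: iM.
rewrite (ae_eq_integral (fun w => (Num.max 0 (du w))%:E))//.
- by apply: integral_ge0 => w _; rewrite lee_fin le_max lexx.
- exact: measurable_funTS.
- by apply: measurable_funTS; apply/measurable_EFinP; exact: measurable_maxr.
apply: filterS (gap_meet_ge0 acX t0 tT) => w H [Sw nMw]; congr (_%:E).
rewrite max_r// /du subr_ge0; apply: u_mono.
(* Because [hit] is capped at [T], the order at the meeting time is here the order at [T]. *)
have mT : meeting_time X t T w = T.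
  have := hit_le (gap X ^~ w) tT 0; rewrite le_eqVlt => /predU1P[//|mT].
  by exfalso; apply: nMw.
by have := H (S_ge0 Sw); rewrite mT subr_ge0.
Qed.

End after_meeting.

(** The event [S] where monotonicity fails is itself in [FF t], so it can serve as test set: the
    integral over it of a strictly negative difference is nonnegative by coupling, which forces [S]
    to be null. *)
Lemma condexp_monotone V : {homo u : x y / x <= y} ->
  is_condexp P (F t) (u \o X T) V ->
  {ae PP, forall w, X t w.1 <= X t w.2 -> V w.1 <= V w.2}.
Proof.
move=> u_mono [_ iV mV EV].
pose S := [set w | 0 <= gap X t w] `&` [set w | V (side false w) < V (side true w)].
have mVside b : measurable_fun setT
    ((V \o side b) : g_sigma_algebraType (FF t) -> R).
  exact: side_adapted.
have FS : FF t S.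
  rewrite -filt_measurableE//; apply: measurableI.
    apply: (@measurable_le _ (g_sigma_algebraType (FF t)) _ (cst 0) (gap X t));
      first exact: measurable_cst.
    exact: (gap_adapted martX).
  exact: (@measurable_lt _ (g_sigma_algebraType (FF t)) _
    (V \o side false) (V \o side true)).
have mS : measurable S by case: FS.
have S_ge0 w : S w -> 0 <= gap X t w by case.
have iVside b : PP.-integrable S (EFin \o (fun w => V (side b w))).
  apply: (integrableS measurableT mS (@subsetT _ _)).
  exact: integrable_side iV.
have iuS b : PP.-integrable S (EFin \o (fun w => u (X T (side b w)))).
  exact: (integrableS measurableT mS (@subsetT _ _) (iuside b)).
have Eb b : (\int[PP]_(w in S) (V (side b w))%:E =
             \int[PP]_(w in S) (u (X T (side b w)))%:E)%E.
  rewrite !(integral_pair_side b)//; [|exact: iuside|exact: integrable_side iV].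
  apply: eq_integral => y _.
  under eq_integral do rewrite pair_sideK.
  under [RHS]eq_integral do rewrite pair_sideK.
  by apply: EV; exact: FS.2.
have iVV : PP.-integrable S (EFin \o (fun w => V (side false w) - V (side true w))).
  by have := integrableB mS (iVside false) (iVside true).
have := @integral_ge0_lt0_ae _ _ _ PP
  (fun w => V (side false w) - V (side true w)) S mS iVV.
have -> : (0 <= \int[PP]_(w in S) (V (side false w) - V (side true w))%:E)%E.
  have := coupling_integral_ge0 FS S_ge0 u_mono.
  under eq_integral do rewrite EFinB.
  under [X in _ -> (_ <= X)%E]eq_integral do rewrite EFinB.
  by rewrite !integralB_EFin// !Eb.
move=> H; have {}H := H _ isT.
apply: filterS (H _) => [w nSw Xw|w [_ /=]]; last by rewrite subr_lt0.
rewrite leNgt; apply/negP => Vw; apply: nSw; split => //=.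
by rewrite /gap subr_ge0.
Qed.

End monotone_expectation.

(** * Functions with prescribed slopes *)

Section slopes.
Context (R : realType) (k K : R).
Hypothesis kK : k <= K.

Lemma slopes_between_norm f x y : slopes_between k K f ->
  `|f x - f y| <= (`|k| + `|K|) * `|x - y|.
Proof.
move=> sf; wlog xy : x y / x <= y.
  by move=> H; have [/H//|/ltW/H] := leP x y; rewrite distrC (distrC y).
move: xy; rewrite le_eqVlt => /predU1P[->|xy]; first by rewrite !subrr normr0 mulr0.
have /andP[l r] := sf x y xy.
rewrite distrC (distrC x) [`|y - x|]gtr0_norm ?subr_gt0//.
have yx0 : 0 <= y - x by rewrite subr_ge0 ltW.
have h1 : - (`|k| * (y - x)) <= k * (y - x).
  by rewrite -mulNr ler_wpM2r// lerNl -normrN ler_norm.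
have h2 : K * (y - x) <= `|K| * (y - x) by rewrite ler_wpM2r// ler_norm.
have h3 : 0 <= `|k| * (y - x) by rewrite mulr_ge0.
have h4 : 0 <= `|K| * (y - x) by rewrite mulr_ge0.
by rewrite ler_norml; lra.
Qed.

Lemma slopes_between_lipschitz f : slopes_between k K f -> lipschitz f.
Proof.
move=> sf; apply: (@klipschitzW _ _ _ (`|k| + `|K|)).
  by apply: (@globally_properfilter _ _ (0, 0)).
move=> -[x y] _ /=.
exact: slopes_between_norm.
Qed.

Lemma slopes_between_continuous f : slopes_between k K f -> continuous f.
Proof.
move=> sf x; apply/cvgrPdist_lt => e e0.
pose L := `|k| + `|K| + 1.
have L0 : 0 < L by rewrite ltr_wpDl// addr_ge0.
near=> y; apply: (@le_lt_trans _ _ (L * `|x - y|)).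
  apply: le_trans (slopes_between_norm x y sf) _.
  by rewrite ler_wpM2r// lerDl.
rewrite mulrC -ltr_pdivlMr//; near: y.
by apply: cvgr_dist_lt => //; rewrite divr_gt0.
Unshelve. all: by end_near. Qed.

(** For [k <= K] this is the support function of the interval [k, K]; it replaces the Lipschitz
    constant times [|s|] in McShane's formula, and its values at [s] and [- s] encode the two slope
    bounds. *)
Definition max_increment (s : R) := Num.max (k * s) (K * s).

Lemma max_increment_pos s : 0 <= s -> max_increment s = K * s.
Proof. by move=> s0; rewrite /max_increment max_r// ler_wpM2r. Qed.

Lemma max_increment_neg s : s <= 0 -> max_increment s = k * s.
Proof. by move=> s0; rewrite /max_increment max_l// ler_wnM2r. Qed.

Lemma max_incrementD r s :
  max_increment (r + s) <= max_increment r + max_increment s.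
Proof.
by rewrite {1}/max_increment ge_max !mulrDr !lerD// le_max lexx ?orbT.
Qed.

(** The cost of a displacement and its return in this asymmetric gauge, which is small with [s]. *)
Lemma max_incrementN s : max_increment s + max_increment (- s) = (K - k) * `|s|.
Proof.
have [s0|s0] := leP 0 s.
  by rewrite max_increment_pos// max_increment_neg ?oppr_le0// ger0_norm//; ring.
rewrite max_increment_neg ?ltW// max_increment_pos ?oppr_ge0 ?ltW//.
by rewrite ltr0_norm//; ring.
Qed.

End slopes.

Lemma ae_ex d (U : measurableType d) (R : realType) (P : probability U R)
  (Q : U -> Prop) : {ae P, forall w, Q w} -> exists w, Q w.
Proof.
move=> aeQ; apply: contrapT => nQ.
have [A [mA A0 /= QA]] := aeQ.
have AT : A = setT.
  by apply/seteqP; split => // w _; apply: QA => Qw; apply: nQ; exists w.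
move: A0; rewrite AT probability_setT => /eqP; apply/negP.
by rewrite onee_eq0.
Qed.

(** By Tonelli's theorem the sections of a measurable null set have measures integrating to 0, so
    almost all of them are null. *)
Lemma ae_pair_side d (U : measurableType d) (R : realType) (P : probability U R)
    b (Q : U * U -> Prop) : {ae (P \x P)%E, forall w, Q w} ->
  {ae P, forall y, {ae P, forall x, Q (pair_side b x y)}}.
Proof.
move=> [A [mA A0 QA]].
have mI : measurable_fun setT (EFin \o \1_A : U * U -> \bar R).
  by apply/measurable_EFinP.
have : (\int[(P \x P)%E]_w (\1_A w)%:E = 0)%E.
  by rewrite integral_indic// setIT; exact: A0.
have I0 w : (0 <= (\1_A w : R)%:E)%E by rewrite lee_fin.
rewrite (ge0_integral_pair_side P b)//.
pose S y := [set x | A (pair_side b x y)].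
have mS y : measurable (S y) by exact: measurable_section.
have E y : (\int[P]_(x in [set x | setT (pair_side b x y)])
    (\1_A (pair_side b x y))%:E = P (S y))%E.
  by rewrite (_ : [set x | _] = setT)// -(setIT (S y)) -integral_indic//.
under eq_integral do rewrite E.
have mPS : measurable_fun setT (fun y => P (S y)).
  under eq_fun do rewrite -E.
  case: b {S mS E}.
    exact: (@measurable_fun_fubini_tonelli_G _ _ _ _ _ P _ mI I0).
  exact: (@measurable_fun_fubini_tonelli_F _ _ _ _ _ P _ mI I0).
move=> H; have : {ae P, forall y, setT y -> P (S y) = 0%E}.
  apply/(ae_eq_integral_abs P measurableT mPS); rewrite -[RHS]H.
  by apply: eq_integral => y _; rewrite gee0_abs.
apply: filterS => y /(_ I) Sy0; exists (S y); split => //.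
by move=> x /= nQ; apply: QA.
Qed.

(** * McShane extension with an essential infimum *)

Section envelope.
Context d (Omega : measurableType d) (R : realType) (P : probability Omega R).
Variables (k K : R) (xi V : Omega -> R).
Hypothesis kK : k <= K.

Let c := max_increment k K.

Hypothesis incr : {ae P, forall w, {ae P, forall w',
  V w <= V w' + c (xi w - xi w')}}.

(* McShane's formula, with the infimum over the graph of [V] against [xi] replaced
   by an essential infimum: no null set has to be chosen. *)
Let below x := [set a | {ae P, forall w, a <= V w + c (x - xi w)}].

Definition envelope x := sup (below x).

Let below_shift x y a : below x a -> below y (a - c (x - y)).
Proof.
apply: filterS => w aw; rewrite lerBlDr (le_trans aw)// -addrA lerD2l.
have -> : x - xi w = (y - xi w) + (x - y) by ring.
exact: max_incrementD.
Qed.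

Let below_has_sup x : has_sup (below x).
Proof.
split.
  have [w0 w0P] := ae_ex incr.
  by exists (V w0 - c (xi w0 - x)); apply: (@below_shift (xi w0)).
(* Were [below x] unbounded, every integer would belong to it, and a point outside countably many
   null sets would have [V w + c (x - xi w)] above all integers. *)
apply: contrapT => nub.
have big (n : nat) : {ae P, forall w, n%:R <= V w + c (x - xi w)}.
  apply: contrapT => nb; apply: nub; exists n%:R => a xa.
  rewrite leNgt; apply/negP => na; apply: nb.
  by apply: filterS xa => w; apply: le_trans; exact: ltW.
have [w wP] := ae_ex (ae_foralln big).
have := wP (Num.truncn (V w + c (x - xi w))).+1.
by rewrite leNgt truncnS_gt.
Qed.

Let envelope_shift x y : envelope x <= envelope y + c (x - y).
Proof.
apply: ge_sup; first exact: (below_has_sup x).1.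
move=> a /(@below_shift _ y) ay; rewrite -lerBlDr.
by apply: ub_le_sup ay; exact: (below_has_sup y).2.
Qed.

Lemma envelope_slopes : slopes_between k K envelope.
Proof.
move=> x y xy; have := envelope_shift x y; have := envelope_shift y x.
rewrite /c max_increment_pos ?subr_ge0 ?(ltW xy)//.
rewrite max_increment_neg ?subr_le0 ?(ltW xy)//.
by rewrite -(opprB y x) mulrN; move: (k * _) (K * _) => a b; lra.
Qed.

(** The bound of the envelope at [x] by the expression at [w] fails on a null set depending on [x],
    so [x = xi w] cannot be substituted. It is used at rational [x] only, and the regularity of the
    envelope carries it to [xi w]. *)
Lemma envelope_ae : {ae P, forall w, envelope (xi w) = V w}.
Proof.
have le_rat : {ae P, forall w, forall m n, if unpickle m is Some q then
    is_true (envelope (ratr q) - n.+1%:R^-1 <= V w + c (ratr q - xi w)) else True}.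
  apply: ae_foralln => m; case: (unpickle m) => [q|]; last by apply: aeW.
  apply: ae_foralln => n.
  have n0 : 0 < n.+1%:R^-1 :> R by rewrite invr_gt0.
  have [a qa ha] := sup_adherent n0 (below_has_sup (ratr q)).
  by apply: filterS qa => w; apply: le_trans; exact: ltW.
apply: filterS2 incr le_rat => w wV H.
apply/eqP; rewrite eq_le; apply/andP; split; last first.
  by apply: ub_le_sup wV; exact: (below_has_sup _).2.
apply/ler_addgt0Pr => e e0.
(* The added 1 keeps the divisor positive when [k = K]. *)
pose L := K - k + 1.
have L0 : 0 < L by rewrite ltr_wpDl// subr_ge0.
have [q] : exists q, ratr q \in `]xi w, xi w + e / 2 / L[.
  by apply: rat_in_itvoo; rewrite ltrDl !divr_gt0.
rewrite in_itv/= => /andP[wq qw].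
have ql : (K - k) * `|ratr q - xi w| <= e / 2.
  rewrite gtr0_norm ?subr_gt0//; apply: (@le_trans _ _ (L * (ratr q - xi w))).
    by rewrite ler_wpM2r ?lerDl// subr_ge0 ltW.
  by rewrite mulrC -ler_pdivlMr// lerBlDl ltW.
pose n := Num.truncn (e / 2)^-1.
have n_e : n.+1%:R^-1 <= e / 2.
  by rewrite invf_ple ?posrE ?divr_gt0// ltW// truncnS_gt.
have := H (pickle q) n; rewrite pickleK => Hq.
have := envelope_shift (xi w) (ratr q).
have := max_incrementN kK (ratr q - xi w); rewrite opprB -/c.
move: Hq ql n_e.
move: (c _) (c _) ((_ - _) * _) (envelope _) (envelope _) (n.+1%:R^-1).
by move=> *; lra.
Qed.

End envelope.

Lemma is_condexp_lin d (Omega : measurableType d) (R : realType)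
    (P : probability Omega R) (G : set_system Omega) (a b : R)
    (U V U' V' : Omega -> R) : G `<=` measurable ->
  is_condexp P G U V -> is_condexp P G U' V' ->
  is_condexp P G (fun w => a * U w + b * U' w) (fun w => a * V w + b * V' w).
Proof.
move=> Gm [iU iV mV EV] [iU' iV' mV' EV'].
have i (W W' : Omega -> R) A : measurable A ->
    P.-integrable A (EFin \o W) -> P.-integrable A (EFin \o W') ->
    P.-integrable A (EFin \o (fun w => a * W w + b * W' w)).
  move=> mA iW iW'.
  by have := integrableD mA (integrableZl mA a iW) (integrableZl mA b iW').
have E (W W' : Omega -> R) A : measurable A ->
    P.-integrable A (EFin \o W) -> P.-integrable A (EFin \o W') ->
    (\int[P]_(w in A) (a * W w + b * W' w)%:E =
     a%:E * \int[P]_(w in A) (W w)%:E + b%:E * \int[P]_(w in A) (W' w)%:E)%E.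
  move=> mA iW iW'; under eq_integral do rewrite EFinD !EFinM.
  rewrite integralD ?integralZl//; first exact: (integrableZl mA a iW).
  exact: (integrableZl mA b iW').
split; [exact: i|exact: i| |].
- by apply: measurable_funD; apply: measurable_funM => //.
- move=> A GA; have mA := Gm A GA.
  have s (W : Omega -> R) :
      P.-integrable setT (EFin \o W) -> P.-integrable A (EFin \o W).
    exact: (integrableS measurableT mA (@subsetT _ _)).
  by rewrite !E ?EV ?EV'//; exact: s.
Qed.

Theorem theorem1p5 (R : realType) (d : measure_display)
    (Omega : measurableType d) (P : probability Omega R)
    (F : filtration Omega R) (X : R -> {RV P >-> R})
    (martX : martingale F X) (diffX : almost_continuous_diffusion F X)
    (g : R -> R) (k K : R) (k_le_K : k <= K)
    (lip_g : lipschitz g) (slope_g : slopes_between k K g)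
    (t T : R) (t_ge0 : 0 <= t) (t_lt_T : t < T) :
  exists f : R -> R,
    [/\ lipschitz f, slopes_between k K f &
        ae_eq_condexp P (F t) (fun w => g (X T w)) (fun w => f (X t w))].
Proof.
have [markX acX] := diffX; have [aX iX _] := martX.
have T0 : 0 <= T by rewrite (le_trans t_ge0)// ltW.
have Fm := filt_sub (f := F) t_ge0.
have cg := slopes_between_continuous slope_g.
have mg : measurable_fun setT g by exact: continuous_measurable_fun.
have igX : P.-integrable setT (EFin \o (g \o X T)).
  pose L := `|k| + `|K|.
  have iL : P.-integrable setT (EFin \o (fun w => `|g 0| + L * `|X T w|)).
    have iXa : P.-integrable setT (EFin \o (fun w => `|X T w|)).
      by have := integrable_abse (iX T T0).
    have ic := finite_measure_integrable_cst P `|g 0| measurableT.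
    by have := integrableD measurableT ic (integrableZl measurableT L iXa).
  apply: (le_integrable measurableT _ _ iL).
    by apply/measurable_EFinP; exact: (measurableT_comp mg).
  move=> w _ /=; rewrite lee_fin (ger0_norm (x := _ + _)); last first.
    by rewrite addr_ge0// mulr_ge0// addr_ge0.
  rewrite -lerBlDl (le_trans (lerB_dist _ _))//.
  rewrite (le_trans (slopes_between_norm _ _ slope_g))//.
  by rewrite subr0.
have [V cV] := condexp_exists (filt_sigma F t_ge0) Fm igX.
(* By adaptedness [X t] is itself a version of the conditional expectation, so linear combinations
   with [V] are versions too. *)
have cX : is_condexp P (F t) (X T) (X t).
  split; [exact: iX|exact: iX|exact: aX|] => A FA.
  exact: martingale_integral martX t_ge0 (ltW t_lt_T) FA.
have clin a b := is_condexp_lin a b Fm cV cX.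
have lin_cont a b : continuous (fun x => a * g x + b * x).
  move=> x; apply: cvgD; apply: cvgM.
  - exact: cvg_cst.
  - exact: cg.
  - exact: cvg_cst.
  - exact: cvg_id.
have mono a b : {homo (fun x => a * g x + b * x) : x y / x <= y} ->
    {ae (P \x P)%E, forall w, X t w.1 <= X t w.2 ->
       a * V w.1 + b * X t w.1 <= a * V w.2 + b * X t w.2}.
  move=> ab; have [iu _ _ _] := clin a b.
  exact: (condexp_monotone martX markX acX t_ge0 t_lt_T
    (lin_cont a b) iu ab (clin a b)).
have lower := mono 1 (- k); have upper := mono (- 1) K.
have slopes : {ae (P \x P)%E, forall w, X t w.1 <= X t w.2 ->
    k * (X t w.2 - X t w.1) <= V w.2 - V w.1 <= K * (X t w.2 - X t w.1)}.
  have {}lower := lower _; have {}upper := upper _.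
  apply: filterS2 (lower _) (upper _) => [w H1 H2 Xw|x y|x y].
  - by have := H1 Xw; have := H2 Xw; lra.
  - rewrite le_eqVlt => /predU1P[->//|/slope_g /andP[]]; lra.
  - rewrite le_eqVlt => /predU1P[->//|/slope_g /andP[]]; lra.
have incr : {ae P, forall w, {ae P, forall w',
    V w <= V w' + max_increment k K (X t w - X t w')}}.
  (* The slope bounds assume that the pair is ordered by [X t]; the two choices of frozen coordinate
     cover both orders. *)
  have /= s1 := ae_pair_side true slopes; have /= s2 := ae_pair_side false slopes.
  apply: filterS2 s1 s2 => w s1 s2; apply: filterS2 s1 s2 => w1 /= H1 H2.
  have [Xw|Xw] := leP (X t w) (X t w1).
    have /andP[l _] := H2 Xw.
    by rewrite max_increment_neg ?subr_le0//; lra.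
  have /andP[_ r] := H1 (ltW Xw).
  by rewrite max_increment_pos ?subr_ge0 ?(ltW Xw)//; lra.
exists (envelope P k K (X t) V).
have es := envelope_slopes k_le_K incr.
split => //; first exact: slopes_between_lipschitz es.
by exists V => //; exact: envelope_ae.
Qed.
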